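(* Suppose that we start CEST from $N$ initial points which are sampled (independently) from $\mathbb{S}^{n-1}$ uniformly and regard the resulting smallest merit function value (the minimum over the $N$ runs of the limiting value of $f(\mathbf{x}_c)$) as the smallest eigenvalue, i.e. the smallest $\lambda\in\mathbb{R}$ for which $\mathcal{T}\mathbf{x}^{k-1}=\lambda\mathcal{B}\mathbf{x}^{k-1}$ has a nonzero solution $\mathbf{x}\in\mathbb{R}^n$. Then there exists a constant $\varsigma\in(0,1]$ (not depending on $N$) such that the probability of obtaining the smallest eigenvalue is at least $$1-(1-\varsigma)^N.$$ Therefore, if the number of samples $N$ is large enough, we obtain the smallest eigenvalue with a high probability (the probability tends to $1$ as $N\to\infty$).
   Context: Problem. For a $k$th order $n$-dimensional real symmetric tensor $\mathcal{T}=(t_{i_1\cdots i_k})$ and $\mathbf{x}\in\mathbb{R}^n$, $\mathcal{T}\mathbf{x}^k=\sum_{i_1,\ldots,i_k=1}^n t_{i_1\cdots i_k}x_{i_1}\cdots x_{i_k}$, and $\mathcal{T}\mathbf{x}^{k-1}\in\mathbb{R}^n$ has $i$th entry $\sum_{i_2,\ldots,i_k=1}^n t_{ii_2\cdots i_k}x_{i_2}\cdots x_{i_k}$. Let $k$ be even and $G=(V,E)$ a $k$-uniform hypergraph with $V=\{1,\ldots,n\}$, $E$ a set of distinct $k$-element subsets of $V$, every vertex lying in at least one edge; $d(i)$ is the number of edges containing $i$. The adjacency tensor $\mathcal{A}$ has entries $\frac{1}{(k-1)!}$ at $(i_1,\ldots,i_k)$ if $\{i_1,\ldots,i_k\}\in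 E$ and $0$ otherwise; $\mathcal{D}$ is the diagonal tensor with $i$th diagonal entry $d(i)$; $\mathcal{L}=\mathcal{D}-\mathcal{A}$, $\mathcal{Q}=\mathcal{D}+\mathcal{A}$. $\mathcal{T}$ is one of $\mathcal{A},\mathcal{L},\mathcal{Q}$; $\mathcal{B}$ is a $k$th order $n$-dimensional real symmetric positive definite tensor ($\mathcal{B}\mathbf{x}^k>0$ for $\mathbf{x}\ne0$). $\mathbb{S}^{n-1}$ is the unit sphere of $\mathbb{R}^n$; $f(\mathbf{x})=\frac{\mathcal{T}\mathbf{x}^k}{\mathcal{B}\mathbf{x}^k}$ and $\mathbf{g}(\mathbf{x})=\nabla f(\mathbf{x})=\frac{k}{\mathcal{B}\mathbf{x}^k}\left(\mathcal{T}\mathbf{x}^{k-1}-\frac{\mathcal{T}\mathbf{x}^k}{\mathcal{B}\mathbf{x}^k}\mathcal{B}\mathbf{x}^{k-1}\right)$ for $\mathbf{x}\ne0$. Algorithm CEST. Parameters: positive integer $L$, $\eta\in(0,1)$, $\beta\in(0,1)$, $\kappa_\epsilon\in(0,1)$. Start from $\mathbf{x}_1\in\mathbb{S}^{n-1}$. For $c=1,2,\ldots$ (stopping if $\mathbf{g}(\mathbf{x}_c)=0$): (1) Set $\mathbf{p}_c=-H_c\mathbf{g}(\mathbf{x}_c)$, where $H_c$ is the L-BFGS matrix: $H_c^{(0)}=\gamma_cI$; for $\ell=L,L-1,\ldots,1$, $H_c^{(L-\ell+1)}=V_{c-\ell}^\top H_c^{(L-\ell)}V_{c-\ell}+\rho_{c-\ell}\mathbf{s}_{c-\ell}\mathbf{s}_{c-\ell}^\top$,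 where for $\ell\ge c$ one puts $\rho_{c-\ell}=0$ and the step does nothing; $H_c=H_c^{(L)}$. Here $\mathbf{y}_j=\mathbf{g}(\mathbf{x}_{j+1})-\mathbf{g}(\mathbf{x}_j)$, $\mathbf{s}_j=\mathbf{x}_{j+1}-\mathbf{x}_j$, $V_j=I-\rho_j\mathbf{y}_j\mathbf{s}_j^\top$, and $\rho_j=1/(\mathbf{y}_j^\top\mathbf{s}_j)$ if $\mathbf{y}_j^\top\mathbf{s}_j\ge\kappa_\epsilon$, $\rho_j=0$ otherwise. The scalar $\gamma_c$ is: $\gamma_1=1$; for $c\ge2$, $\gamma_c=1$ if $\mathbf{y}_{c-1}^\top\mathbf{s}_{c-1}<\kappa_\epsilon$, and otherwise $\gamma_c$ is one of $\frac{\mathbf{y}_{c-1}^\top\mathbf{s}_{c-1}}{\|\mathbf{y}_{c-1}\|^2}$, $\frac{\|\mathbf{s}_{c-1}\|^2}{\mathbf{y}_{c-1}^\top\mathbf{s}_{c-1}}$, $\frac{\|\mathbf{s}_{c-1}\|}{\|\mathbf{y}_{c-1}\|}$. (2) With $\mathbf{x}_{c+1}(\alpha)=\frac{[(1-\alpha\mathbf{x}_c^\top\mathbf{p}_c)^2-\|\alpha\mathbf{p}_c\|^2]\mathbf{x}_c+2\alpha\mathbf{p}_c}{1+\|\alpha\mathbf{p}_c\|^2-(\alpha\mathbf{x}_c^\top\mathbf{p}_c)^2}$, let $\ell$ be the smallest nonnegative integer such that $\alpha=\beta^\ell$ satisfies $f(\mathbf{x}_{c+1}(\alpha))\le f(\mathbf{x}_c)+\eta\alpha\,\mathbf{p}_c^\top\mathbf{g}(\mathbf{x}_c)$;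 set $\alpha_c=\beta^\ell$ and $\mathbf{x}_{c+1}=\mathbf{x}_{c+1}(\alpha_c)\in\mathbb{S}^{n-1}$. The limiting merit function value of a run is $\lim_{c\to\infty}f(\mathbf{x}_c)$, or $f(\mathbf{x}_c)$ at the last iterate if the run stops finitely with $\mathbf{g}(\mathbf{x}_c)=0$. *)

(* Defs.v *)
From HB Require Import structures.
From mathcomp Require Import all_boot all_order all_algebra.
From mathcomp Require Import all_classical all_reals all_analysis.
Set Implicit Arguments.
Unset Strict Implicit.
Unset Printing Implicit Defensive.
Import Order.TTheory GRing.Theory Num.Theory.
Import numFieldNormedType.Exports.
Local Open Scope classical_set_scope.
Local Open Scope ring_scope.

(** The norm carried by ['cV[R]_n] in the library is the sup norm, so the
    Euclidean structure is spelled out. *)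

Definition dot (R : realType) n (u v : 'cV[R]_n) : R := (u^T *m v) 0 0.

Definition enorm (R : realType) n (u : 'cV[R]_n) : R := Num.sqrt (dot u u).

Definition unit_sphere (R : realType) n : set 'cV[R]_n :=
  [set x | enorm x = 1].

Notation tensor R k n := {ffun k.-tuple 'I_n -> R}.

Definition symmetric_tensor (R : realType) k n (T : tensor R k n) : Prop :=
  forall s t : k.-tuple 'I_n, perm_eq s t -> T s = T t.

(** T x^k *)
Definition tform (R : realType) k n (T : tensor R k n) (x : 'cV[R]_n) : R :=
  \sum_(s : k.-tuple 'I_n) T s * \prod_(j <- s) x j 0.

(** T x^(k-1), for k > 0: the index (i, i_2, ..., i_k) runs over the k-tuples
    whose head is i. *)
Definition tvec (R : realType) k n (T : tensor R k n) (x : 'cV[R]_n) :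
    'cV[R]_n :=
  \col_i \sum_(s : k.-tuple 'I_n | ohead s == Some i)
            T s * \prod_(j <- behead s) x j 0.

Definition positive_definite (R : realType) k n (B : tensor R k n) : Prop :=
  forall x : 'cV[R]_n, x != 0 -> 0 < tform B x.

Definition is_eigenvalue (R : realType) k n (T B : tensor R k n) (lam : R) :
    Prop :=
  exists2 x : 'cV[R]_n, x != 0 & tvec T x = lam *: tvec B x.

Definition is_smallest_eigenvalue (R : realType) k n (T B : tensor R k n)
    (lam : R) : Prop :=
  is_eigenvalue T B lam /\ forall mu, is_eigenvalue T B mu -> lam <= mu.

Definition uniform_hypergraph k n (E : {set {set 'I_n}}) : Prop :=
  (forall e, e \in E -> #|e| = k) /\
  (forall i, exists2 e, e \in E & i \in e).

Definition degree n (E : {set {set 'I_n}}) (i : 'I_n) : nat :=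
  #|[set e in E | i \in e]|.

Definition adjacency_tensor (R : realType) k n (E : {set {set 'I_n}}) :
    tensor R k n :=
  [ffun s : k.-tuple 'I_n =>
     if [set i in s] \in E then ((k.-1)`!)%:R^-1 else 0].

(** For k > 0 at most one i contributes, namely when s = (i, ..., i). *)
Definition degree_tensor (R : realType) k n (E : {set {set 'I_n}}) :
    tensor R k n :=
  [ffun s : k.-tuple 'I_n => \sum_(i | all (pred1 i) s) (degree E i)%:R].

Definition laplacian_tensor (R : realType) k n (E : {set {set 'I_n}}) :
    tensor R k n := degree_tensor R k E - adjacency_tensor R k E.

Definition signless_laplacian_tensor (R : realType) k n
    (E : {set {set 'I_n}}) : tensor R k n :=
  degree_tensor R k E + adjacency_tensor R k E.

Definition merit (R : realType) k n (T B : tensor R k n) (x : 'cV[R]_n) : R :=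
  tform T x / tform B x.

Definition merit_grad (R : realType) k n (T B : tensor R k n) (x : 'cV[R]_n) :
    'cV[R]_n :=
  (k%:R / tform B x) *: (tvec T x - (tform T x / tform B x) *: tvec B x).

(** Iterates of a run [x] are indexed from 1: [x 0] is never used. *)

Definition ydiff (R : realType) n (g : 'cV[R]_n -> 'cV[R]_n)
    (x : nat -> 'cV[R]_n) j : 'cV[R]_n := g (x j.+1) - g (x j).

Definition sdiff (R : realType) n (x : nat -> 'cV[R]_n) j : 'cV[R]_n :=
  x j.+1 - x j.

Definition rho (R : realType) n (g : 'cV[R]_n -> 'cV[R]_n) (kappa : R)
    (x : nat -> 'cV[R]_n) j : R :=
  if kappa <= dot (ydiff g x j) (sdiff x j)
  then (dot (ydiff g x j) (sdiff x j))^-1 else 0.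

Definition Vmx (R : realType) n (g : 'cV[R]_n -> 'cV[R]_n) (kappa : R)
    (x : nat -> 'cV[R]_n) j : 'M[R]_n :=
  1%:M - rho g kappa x j *: (ydiff g x j *m (sdiff x j)^T).

(** [lbfgs g kappa L x gam c m] is H_c^(m) started from gam I; the step from m
    to m+1 is the one of index l = L - m, so H_c is obtained for m = L. *)
Fixpoint lbfgs (R : realType) n (g : 'cV[R]_n -> 'cV[R]_n) (kappa : R)
    (L : nat) (x : nat -> 'cV[R]_n) (gam : R) (c m : nat) : 'M[R]_n :=
  if m is m'.+1 then
    let H := lbfgs g kappa L x gam c m' in
    let l := (L - m')%N in
    if (l < c)%N then
      (Vmx g kappa x (c - l))^T *m H *m Vmx g kappa x (c - l)
      + rho g kappa x (c - l) *: (sdiff x (c - l) *m (sdiff x (c - l))^T)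
    else H
  else gam%:M.

Definition gamma_choice (R : realType) n (g : 'cV[R]_n -> 'cV[R]_n)
    (kappa : R) (x : nat -> 'cV[R]_n) (c : nat) (gam : R) : Prop :=
  let y := ydiff g x c.-1 in
  let s := sdiff x c.-1 in
  if (c <= 1)%N || (dot y s < kappa) then gam = 1
  else [\/ gam = dot y s / enorm y ^+ 2,
           gam = enorm s ^+ 2 / dot y s
         | gam = enorm s / enorm y].

Definition curve (R : realType) n (x p : 'cV[R]_n) (a : R) : 'cV[R]_n :=
  (1 + enorm (a *: p) ^+ 2 - (a * dot x p) ^+ 2)^-1 *:
  (((1 - a * dot x p) ^+ 2 - enorm (a *: p) ^+ 2) *: x + (2 * a) *: p).

Definition armijo (R : realType) n (f : 'cV[R]_n -> R)
    (g : 'cV[R]_n -> 'cV[R]_n) (eta : R) (x p : 'cV[R]_n) (a : R) : Prop :=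
  f (curve x p a) <= f x + eta * a * dot p (g x).

Definition cest_step (R : realType) n (f : 'cV[R]_n -> R)
    (g : 'cV[R]_n -> 'cV[R]_n) (L : nat) (eta beta kappa : R)
    (x : nat -> 'cV[R]_n) (c : nat) : Prop :=
  exists gam : R, gamma_choice g kappa x c gam /\
  let p := - (lbfgs g kappa L x gam c L *m g (x c)) in
  exists l : nat,
    [/\ armijo f g eta (x c) p (beta ^+ l),
        (forall m : nat, (m < l)%N -> ~ armijo f g eta (x c) p (beta ^+ m))
      & x c.+1 = curve (x c) p (beta ^+ l)].

(** The choice of gamma_c being free, a run is described by a relation; the
    values of [x] after the stopping index, if any, are irrelevant. *)
Definition cest_run (R : realType) n (f : 'cV[R]_n -> R)
    (g : 'cV[R]_n -> 'cV[R]_n) (L : nat) (eta beta kappa : R)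
    (x : nat -> 'cV[R]_n) : Prop :=
  unit_sphere (x 1%N) /\
  forall c : nat, (0 < c)%N ->
    (forall i : nat, (0 < i <= c)%N -> g (x i) != 0) ->
    cest_step f g L eta beta kappa x c.

Definition limiting_value (R : realType) n (f : 'cV[R]_n -> R)
    (g : 'cV[R]_n -> 'cV[R]_n) (x : nat -> 'cV[R]_n) (v : R) : Prop :=
  (exists c : nat,
     [/\ (0 < c)%N, g (x c) = 0,
         (forall i : nat, (0 < i < c)%N -> g (x i) != 0) & v = f (x c)])
  \/
  ((forall c : nat, (0 < c)%N -> g (x c) != 0) /\
   f (x c) @[c --> \oo] --> v).

Definition borel_set (R : realType) n : set (set 'cV[R]_n) :=
  <<s [set U : set 'cV[R]_n | open U] >>.

Definition random_vector (R : realType) n d (Om : measurableType d)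
    (X : Om -> 'cV[R]_n) : Prop :=
  forall A : set 'cV[R]_n, borel_set A -> measurable (X @^-1` A).

(** The uniform distribution on the sphere is its unique rotation-invariant
    Borel probability, i.e. the normalized surface measure. *)
Definition uniform_on_sphere (R : realType) n d (Om : measurableType d)
    (P : probability Om R) (X : Om -> 'cV[R]_n) : Prop :=
  [/\ random_vector X,
      (forall om, unit_sphere (X om))
    & forall (Q : 'M[R]_n) (A : set 'cV[R]_n), Q^T *m Q = 1%:M -> borel_set A ->
        P ((fun om => Q *m X om) @^-1` A) = P (X @^-1` A)].

Definition mutually_independent (R : realType) n d (Om : measurableType d)
    (P : probability Om R) N (X : 'I_N -> Om -> 'cV[R]_n) : Prop :=
  forall (J : {set 'I_N}) (A : 'I_N -> set 'cV[R]_n),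
    (forall j, borel_set (A j)) ->
    P [set om | forall j, j \in J -> A j (X j om)]
    = (\prod_(j in J) P (X j @^-1` A j))%E.

(** [x j om] is the run started from the j-th initial point [X j om]. *)
Definition cest_experiment (R : realType) n (f : 'cV[R]_n -> R)
    (g : 'cV[R]_n -> 'cV[R]_n) (L : nat) (eta beta kappa : R)
    d (Om : measurableType d) (P : probability Om R) N
    (X : 'I_N -> Om -> 'cV[R]_n) (x : 'I_N -> Om -> nat -> 'cV[R]_n) : Prop :=
  [/\ (forall j, uniform_on_sphere P (X j)),
      mutually_independent P X
    & forall j om, x j om 1%N = X j om /\
                   cest_run f g L eta beta kappa (x j om)].

Definition obtains_smallest_eigenvalue (R : realType) k n (T B : tensor R k n)
    (Om : Type) N (x : 'I_N -> Om -> nat -> 'cV[R]_n) : set Om :=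
  [set om | exists v : 'I_N -> R,
     (forall j, limiting_value (merit T B) (merit_grad T B) (x j om) (v j)) /\
     exists lam : R,
       [/\ (exists j, v j = lam), (forall j, lam <= v j)
         & is_smallest_eigenvalue T B lam]].

(** The free choice of gamma_c may be made non-measurably, in which case the
    event above need not be measurable.  Its probability is bounded from below
    through measurable events it contains; see [inner_probE]. *)
Definition inner_prob (R : realType) d (Om : measurableType d)
    (P : probability Om R) (A : set Om) : \bar R :=
  ereal_sup [set P F | F in [set F | measurable F /\ F `<=` A]].

Lemma inner_probE (R : realType) d (Om : measurableType d)
    (P : probability Om R) (A : set Om) : measurable A -> inner_prob P A = P A.
Proof.
move=> mA; apply/eqP; rewrite eq_le; apply/andP; split.
- apply: ge_ereal_sup => _ [F [mF FA] <-].
  by apply: le_measure => //; rewrite inE.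
- by apply: ereal_sup_ubound; exists A => //; split.
Qed.

(* Main.v *)
(* The function f is T x^k / B x^k. On the sphere its critical values are the
   eigenvalues, its minimum lam is the smallest one, and there are only
   finitely many eigenvalues. Hence for some lam2 > lam no eigenvalue lies
   strictly between lam and lam2, and U = {f < lam2} is an open set meeting the
   sphere. A run never leaves the sphere. The L-BFGS matrices are uniformly
   bounded and uniformly positive definite, so the step lengths are bounded
   below and f(x_c) decreases by at least c0 |g(x_c)|^2; therefore f(x_c)
   converges to an eigenvalue that is at most f(x_1), and this is lam as soon as
   x_1 is in U. Since the sphere is covered by some M rotations of U, a
   rotation-invariant initial point lies in U with probability at least 1/M. *)

(* The gap above [lam] is what turns a start near the minimum into convergence to the minimum: if
   eigenvalues accumulated at [lam] from above, a run could stop at any of them. The gap comes from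
   the heuristic that an eigenvalue cannot vary along a curve of eigenpairs, since differentiating T
   x^k = l B x^k and using the eigenvalue equation leaves l' B x^k = 0. No curve has to be found: a
   sequence of distinct eigenvalues is read as a single element of an ultrapower, and the derivative
   is a formal derivation there. The bounds on the L-BFGS matrices are uniform for two reasons:
   pairs with y.s < kappa are discarded, and each matrix results from at most L updates of a scalar
   matrix, whatever the iteration. Only the values f(x_c) are shown to converge, which is enough
   because the sphere is compact and f and its gradient are continuous on it. Invariance is under
   all orthogonal matrices, so reflections are enough to carry any point of the sphere to any
   other. *)
Require Import Defs.
From HB Require Import structures.
From mathcomp Require Import all_boot all_order all_algebra.
From mathcomp Require Import all_classical all_reals all_analysis.
From mathcomp Require Import ring lra zify.
From mathcomp Require finmap.
Set Implicit Arguments.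
Unset Strict Implicit.
Unset Printing Implicit Defensive.
Import Order.TTheory GRing.Theory Num.Theory.
Import numFieldNormedType.Exports.
Local Open Scope classical_set_scope.
Local Open Scope ring_scope.

(** * Finiteness of the set of eigenvalues *)

(* A derivation from a subring of K to K is encoded by its graph, a subset of
   K * K that is a subring of the dual numbers over K. *)
Record derivation_graph (K : fieldType) (D : K -> K -> Prop) : Prop := {
  graph1 : D 1 0;
  graphB : forall a a' b b', D a a' -> D b b' -> D (a - b) (a' - b');
  graphM : forall a a' b b',
    D a a' -> D b b' -> D (a * b) (a' * b + a * b');
  graph_fun : forall a', D 0 a' -> a' = 0 }.

Section DerivationGraph.
Variables (K : fieldType) (D : K -> K -> Prop).
Hypothesis gD : derivation_graph D.

Lemma graph0 : D 0 0.
Proof. by have := graphB gD (graph1 gD) (graph1 gD); rewrite !subrr. Qed.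

Lemma graphN a a' : D a a' -> D (- a) (- a').
Proof. by move=> h; have := graphB gD graph0 h; rewrite !sub0r. Qed.

Lemma graphD a a' b b' : D a a' -> D b b' -> D (a + b) (a' + b').
Proof. by move=> ha /graphN hb; have := graphB gD ha hb; rewrite !opprK. Qed.

Lemma graph_inj a a' a'' : D a a' -> D a a'' -> a' = a''.
Proof.
move=> h1 h2; apply/eqP; rewrite -subr_eq0; apply/eqP.
by apply: (graph_fun gD); have := graphB gD h1 h2; rewrite subrr.
Qed.

Lemma graph_sum (I : Type) (r : seq I) (P : pred I) (F F' : I -> K) :
  (forall i, P i -> D (F i) (F' i)) ->
  D (\sum_(i <- r | P i) F i) (\sum_(i <- r | P i) F' i).
Proof.
move=> h; elim/big_rec2: _ => [|i y x Pi]; first exact: graph0.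
exact: graphD (h _ Pi).
Qed.

Lemma graph_nat m : D m%:R 0.
Proof.
elim: m => [|m IH]; first exact: graph0.
by rewrite -natr1 -[0]addr0; apply: graphD (graph1 gD).
Qed.

Definition poly_graph (p q : {poly K}) := forall i, D p`_i q`_i.

Lemma poly_graphB p q p' q' :
  poly_graph p q -> poly_graph p' q' -> poly_graph (p - p') (q - q').
Proof. by move=> h h' i; rewrite !coefB; exact: graphB. Qed.

Lemma poly_graphM p q p' q' : poly_graph p q -> poly_graph p' q' ->
  poly_graph (p * p') (q * p' + p * q').
Proof.
move=> h h' i; rewrite coefD !coefM -big_split /=.
by apply: graph_sum => j _; exact: graphM.
Qed.

Lemma poly_graphC a a' : D a a' -> poly_graph a%:P a'%:P.
Proof. by move=> h i; rewrite !coefC; case: eqP => // _; exact: graph0. Qed.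

Lemma poly_graphXn m : poly_graph 'X^m 0.
Proof. by move=> i; rewrite coefXn coef0; exact: graph_nat. Qed.

Lemma poly_graph0 q : poly_graph 0 q -> q = 0.
Proof.
move=> h; apply/polyP => i; rewrite coef0.
by apply: (graph_fun gD); have := h i; rewrite coef0.
Qed.

Lemma poly_graph_deriv p q : poly_graph p q -> poly_graph p^`() q^`().
Proof.
move=> h i; rewrite !coef_deriv.
have := graphM gD (h i.+1) (graph_nat i.+1).
by rewrite mulr0 addr0 !mulr_natr.
Qed.

(** The chain rule leaves no other value: if D extends to [x] with value [u], then p(x) must go to
    q(x) + p'(x) u, where q is p with differentiated coefficients. *)
Definition adjoin_graph (x u : K) (a a' : K) : Prop :=
  exists p q, [/\ poly_graph p q, a = p.[x] & a' = q.[x] + p^`().[x] * u].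

(** The ring operations are respected for any [u]; only single-valuedness can fail, when two
    polynomials agree at [x], and the hypothesis excludes exactly that. *)
Lemma adjoin_graph_derivation x u :
  (forall p q, poly_graph p q -> p.[x] = 0 -> q.[x] + p^`().[x] * u = 0) ->
  derivation_graph (adjoin_graph x u).
Proof.
move=> hu; split.
- exists 1, 0; split; rewrite ?hornerC //.
    exact: (poly_graphC (graph1 gD)).
  by rewrite derivC !hornerC mul0r addr0.
- move=> _ _ _ _ [p [q [h -> ->]]] [p1 [q1 [h1 -> ->]]].
  exists (p - p1), (q - q1); split; first exact: poly_graphB.
    by rewrite !hornerE.
  by rewrite derivB !hornerE; ring.
- move=> _ _ _ _ [p [q [h -> ->]]] [p1 [q1 [h1 -> ->]]].
  exists (p * p1), (q * p1 + p * q1); split; first exact: poly_graphM.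
    by rewrite !hornerE.
  by rewrite derivM !hornerE; ring.
- by move=> a' [p [q [h /esym p0 ->]]]; exact: hu.
Qed.

Lemma adjoin_graph_sub x u a a' : D a a' -> adjoin_graph x u a a'.
Proof.
move=> h; exists a%:P, a'%:P; split; rewrite ?hornerC //.
  exact: poly_graphC.
by rewrite derivC !hornerC mul0r addr0.
Qed.

Lemma adjoin_graph_gen x u : adjoin_graph x u x u.
Proof.
exists 'X, 0; split; rewrite ?hornerX //; first exact: (poly_graphXn 1).
by rewrite derivX !hornerC mul1r add0r.
Qed.

(** Without a relation satisfied by [x] nothing constrains [u]. The value 1 yields differentiation
    with respect to [x]. *)
Lemma adjoin_transcendental x u :
  (forall p q, poly_graph p q -> p.[x] = 0 -> p = 0) ->
  derivation_graph (adjoin_graph x u).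
Proof.
move=> tr; apply: adjoin_graph_derivation => p q h /(tr _ _ h) p0.
by move: h; rewrite p0 => /poly_graph0 ->; rewrite derivC !hornerC mul0r addr0.
Qed.

(* For x algebraic, the value u of the derivation at x is forced by an
   annihilating polynomial m of least degree, since m'(x) <> 0; another
   annihilating polynomial is reduced to smaller degree by m after scaling by
   the leading coefficient of m. *)
Lemma derivation_extension x : [pchar K] =i pred0 ->
  exists D' : K -> K -> Prop,
    [/\ derivation_graph D', (forall a a', D a a' -> D' a a')
      & exists u, D' x u].
Proof.
move=> char0.
have [tr|] := pselect (forall p q, poly_graph p q -> p.[x] = 0 -> p = 0).
  exists (adjoin_graph x 0); split; first exact: adjoin_transcendental.
    exact: adjoin_graph_sub.
  by exists 0; exact: adjoin_graph_gen.
move=> /existsNP[p0 /existsNP[q0 /not_implyP[h0 /not_implyP[p0x p0N0]]]].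
pose Ann j := `[< exists p q, [/\ poly_graph p q, p.[x] = 0, p != 0
                                & size p = j] >].
have exAnn : exists j, Ann j.
  by exists (size p0); apply/asboolP; exists p0, q0; split => //; apply/eqP.
case: (ex_minnP exAnn) => j /asboolP[m [w [hm mx mN0 <-]]] mmin {j}.
have low p q : poly_graph p q -> p.[x] = 0 -> (size p < size m)%N -> p = 0.
  move=> h px; rewrite ltnNge => /negP szp; apply/eqP/negPn/negP => pN0.
  by apply: szp; apply: mmin; apply/asboolP; exists p, q; split.
have m'x : m^`().[x] != 0.
  apply/eqP => m'x0.
  have /polyP m'0 := low _ _ (poly_graph_deriv hm) m'x0 (lt_size_deriv mN0).
  have : size m != 1%N.
    apply: contra_neqN mN0 => /eqP /eqP/size_poly1P[c cN0 mE].
    by move: mx; rewrite mE hornerC => /eqP; rewrite (negPf cN0).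
  move: mN0; rewrite -size_poly_gt0; case sz: (size m) => [|[|j]] // _ _.
  have := m'0 j; rewrite coef_deriv coef0 => /eqP.
  rewrite -mulr_natr mulf_eq0 -[m`_j.+1]/(m`_(j.+2.-1)) -sz -lead_coefE.
  rewrite lead_coef_eq0 -size_poly_eq0 sz /=.
  by rewrite ((pcharf0P K).1 char0).
have [u um] : exists u, w.[x] + m^`().[x] * u = 0.
  by exists (- w.[x] / m^`().[x]); rewrite mulrC divfK // subrr.
exists (adjoin_graph x u); split; last 2 first.
- exact: adjoin_graph_sub.
- by exists u; exact: adjoin_graph_gen.
apply: adjoin_graph_derivation => p q.
have [n] := ubnP (size p); elim: n => // n IH in p q *.
rewrite ltnS => szp h px.
have [lt_pm|le_mp] := ltnP (size p) (size m).
  have pE := low _ _ h px lt_pm; move: h; rewrite pE => /poly_graph0 ->.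
  by rewrite derivC !hornerC mul0r addr0.
pose c := lead_coef m; pose a := lead_coef p; pose e := (size p - size m)%N.
have cN0 : c != 0 by rewrite lead_coef_eq0.
have [c' hc] : exists c', D c c' by exists w`_(size m).-1; exact: hm.
have [a' ha] : exists a', D a a' by exists q`_(size p).-1; exact: h.
have h1 := poly_graphM (poly_graphC hc) h.
have h2 := poly_graphM (poly_graphM (poly_graphC ha) (poly_graphXn e)) hm.
have h3 := poly_graphB h1 h2.
have pN0 : p != 0.
  by rewrite -size_poly_gt0 (leq_trans _ le_mp) // size_poly_gt0.
have sz3 : (size (c%:P * p - a%:P * 'X^e * m)%R < n)%N.
  have szm : (0 < size m)%N by rewrite size_poly_gt0.
  apply: leq_trans szp.
  have szp0 : (0 < size p)%N by rewrite size_poly_gt0.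
  rewrite -(prednK szp0) ltnS; apply/leq_sizeP => i.
  rewrite leq_eqVlt => /orP[/eqP <-|lti].
    rewrite coefB coefCM -mulrA coefCM coefXnM.
    rewrite ltnNge /e; have -> : (size p - size m <= (size p).-1)%N.
      by rewrite -ltnS prednK // ltn_subrL szm szp0.
    rewrite /=.
    have -> : ((size p).-1 - (size p - size m))%N = (size m).-1.
      by rewrite -subn1 subnAC subKn // subn1.
    by rewrite -!lead_coefE -/c -/a mulrC subrr.
  rewrite coefB coefCM -mulrA coefCM coefXnM.
  rewrite (nth_default _ (_ : (size p <= i)%N)); last by rewrite -(prednK szp0).
  rewrite mulr0; case: ltnP => _; first by rewrite mulr0 subr0.
  rewrite nth_default ?mulr0 ?subrr // /e.
  by move: (size p) (size m) le_mp szp0 lti => s t; lia.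
have := IH _ _ sz3 h3.
rewrite !derivB !derivM !derivC !hornerE px mx !mulr0 !subr0 => /(_ erefl).
rewrite !(mul0r, addr0, add0r) => hz.
have : c * (q.[x] + p^`().[x] * u) = 0.
  (* As p and m vanish at [x], [hz] is c (q(x) + p'(x) u) minus a x^e times the equation that
     defines [u]. *)
  have um' := congr1 (fun z => a * x ^+ e * z) um; rewrite mulr0 in um'.
  rewrite -[RHS]hz -[LHS]subr0 -um'; ring.
by move/eqP; rewrite mulf_eq0 (negPf cN0) => /eqP.
Qed.

End DerivationGraph.

(** * An ultrapower of a field *)

Section Ultrapower.
Variables (R : fieldType) (U : set_system nat).
Hypothesis U_ultra : UltraFilter U.

(** The sequences that vanish almost everywhere in the sense of [U]. The ideal is maximal because
    [U] is an ultrafilter. *)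
Definition ultra_null : {pred (nat -> R)} :=
  fun a => `[< U [set m | a m = 0] >].

Lemma ultra_null_idealr : idealr_closed ultra_null.
Proof.
split.
- by apply/asboolP; apply: filterS filterT.
- apply/negP => /asboolP /filter_ex[m /= /eqP].
  by rewrite -[(1 : nat -> R) m]/(1 : R) oner_eq0.
- move=> a u v /asboolP Uu /asboolP Uv; apply/asboolP.
  apply: filterS (filterI Uu Uv) => m /= [um vm].
  by rewrite -[(a * u + v) m]/(a m * u m + v m) um vm mulr0 addr0.
Qed.

HB.instance Definition _ := isIdealr.Build _ ultra_null ultra_null_idealr.

Definition ultrapower := {ideal_quot ultra_null}.

HB.instance Definition _ := GRing.ComNzRing.on ultrapower.

Definition to_ultrapower : (nat -> R) -> ultrapower :=
  \pi_{ideal_quot ultra_null}%qT.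

HB.instance Definition _ := GRing.RMorphism.on to_ultrapower.

Lemma to_ultrapower_eq (a b : nat -> R) :
  to_ultrapower a = to_ultrapower b <-> U [set m | a m = b m].
Proof.
split=> [/eqP|Uab].
  rewrite -Quotient.idealrBE => /asboolP; apply: filterS => m /= /eqP.
  by rewrite -[(a - b) m]/(a m - b m) subr_eq0 => /eqP.
apply/eqP; rewrite -Quotient.idealrBE.
apply/asboolP; apply: filterS Uab => m /=.
by rewrite -[(a - b) m]/(a m - b m) => ->; rewrite subrr.
Qed.

Definition ultrapower_inv (x : ultrapower) : ultrapower :=
  to_ultrapower (fun m => (repr x m)^-1).

(** Either the zero set of a representative or its complement is in [U]. In the first case x = 0; in
    the second the termwise inverse is an inverse almost everywhere. *)
Lemma ultrapower_mulVf x : x != 0 -> ultrapower_inv x * x = 1.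
Proof.
move=> xN0; have xE : x = to_ultrapower (repr x).
  by rewrite /to_ultrapower reprK.
rewrite {2}xE -rmorphM -(rmorph1 to_ultrapower); apply/to_ultrapower_eq.
have [/(to_ultrapower_eq _ 0)|] :=
  in_ultra_setVsetC [set m | repr x m = 0] U_ultra.
  by rewrite -xE rmorph0 => /eqP; rewrite (negPf xN0).
by apply: filterS => m /= /eqP xm; exact: mulVf.
Qed.

Lemma ultrapower_inv0 : ultrapower_inv 0 = 0.
Proof.
rewrite /ultrapower_inv -[RHS](rmorph0 to_ultrapower); apply/to_ultrapower_eq.
have : to_ultrapower (repr (0 : ultrapower)) = to_ultrapower 0.
  by rewrite rmorph0 /to_ultrapower reprK.
move/to_ultrapower_eq; apply: filterS => m /= rm.
by rewrite rm; exact: invr0.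
Qed.

HB.instance Definition _ :=
  GRing.ComNzRing_isField.Build ultrapower ultrapower_mulVf ultrapower_inv0.

End Ultrapower.

(** The ultrafilter refines the filter of tails, so each of its sets meets every tail; a sequence
    that is eventually nonzero is therefore not null. *)
Lemma exists_ultrapower (R : fieldType) :
  exists (K : fieldType) (phi : {rmorphism (nat -> R) -> K}),
    forall (a : nat -> R) N, (forall m, (N <= m)%N -> a m != 0) -> phi a != 0.
Proof.
have [U [U_ultra sU]] :=
  ultraFilterLemma (eventually_filter : ProperFilter \oo).
exists (@ultrapower R U U_ultra), (@to_ultrapower R U U_ultra) => a N aN0.
apply/eqP; rewrite -(rmorph0 (@to_ultrapower R U U_ultra)).
move=> /to_ultrapower_eq Ua.
have : U [set m | (N <= m)%N] by apply: sU; exact: nbhs_infty_ge.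
move=> /(filterI Ua)/filter_ex[m /= [am Nm]].
by have := aN0 _ Nm; rewrite am eqxx.
Qed.

(** * Differentials of products and of symmetric forms *)

Section ProductDifferential.
Variables (A : comNzRingType) (I : Type).
Implicit Types (x d : I -> A) (s : seq I).

(** The Leibniz rule over any commutative ring: it serves both for the formal derivation on the
    ultrapower and for the Taylor expansion over the reals. *)
Fixpoint prod_diff x d s : A :=
  if s is a :: s' then d a * \prod_(j <- s') x j + x a * prod_diff x d s'
  else 0.

Definition head_diff x d s : A :=
  if s is a :: s' then d a * \prod_(j <- s') x j else 0.

(** Each Leibniz term differentiates the head of some rotation of the list. This matches T x^(k-1),
    where the first index is the one left free. *)
Lemma prod_diff_rot x d s :
  prod_diff x d s = \sum_(p < size s) head_diff x d (rot p s).
Proof.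
elim: s => [|a s IH] /=; first by rewrite big_ord0.
rewrite big_ord_recl rot0 /= IH mulr_sumr; congr (_ + _).
apply: eq_bigr => p _; rewrite /bump /= add1n.
have := ltn_ord p; rewrite /rot /= -subn_gt0 -size_drop.
case: (drop p s) => // b t _ /=.
by rewrite !big_cat /= big_cons; ring.
Qed.

End ProductDifferential.

Section TensorAlgebra.
Variables (A : comNzRingType) (k n : nat).
Implicit Types (T : k.-tuple 'I_n -> A) (x d : 'I_n -> A).

Definition gform T x : A := \sum_s T s * \prod_(j <- s) x j.

Definition gvec T x i : A :=
  \sum_(s : k.-tuple 'I_n | ohead s == Some i) T s * \prod_(j <- behead s) x j.

Lemma sum_head_diff T x d :
  \sum_s T s * head_diff x d s = \sum_i d i * gvec T x i.
Proof.
under [RHS]eq_bigr do rewrite mulr_sumr.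
rewrite (exchange_big_dep predT) //=; apply: eq_bigr => -[[|a s] sz] _ /=.
  by rewrite mulr0 big_pred0.
rewrite (big_pred1 a) => [|i]; first exact: mulrCA.
by apply/eqP/eqP => [[->]|->].
Qed.

Lemma gform_euler T x : (0 < k)%N -> \sum_i x i * gvec T x i = gform T x.
Proof.
move=> k_gt0; rewrite -sum_head_diff; apply: eq_bigr => -[[|a s] sz] _ /=.
  by exfalso; have /eqP k0 := sz; move: k_gt0; rewrite -k0.
by rewrite big_cons.
Qed.

Lemma rot_tuple_bij p : bijective (fun s : k.-tuple 'I_n => [tuple of rot p s]).
Proof.
by exists (fun s : k.-tuple 'I_n => [tuple of rotr p s]) => s;
  apply/val_inj; rewrite /= ?rotK ?rotrK.
Qed.

(** Rotating the index permutes the tuples and leaves a symmetric T unchanged, so the k Leibniz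
    terms have equal sums. *)
Lemma sum_prod_diff T x d :
  (forall s t : k.-tuple 'I_n, perm_eq s t -> T s = T t) ->
  \sum_s T s * prod_diff x d s = k%:R * \sum_i d i * gvec T x i.
Proof.
move=> Tsym; under eq_bigr do rewrite prod_diff_rot size_tuple mulr_sumr.
rewrite exchange_big /= -sum_head_diff mulr_natl.
rewrite -[X in _ *+ X]card_ord -sumr_const.
apply: eq_bigr => p _.
rewrite [RHS](reindex _ (onW_bij _ (rot_tuple_bij p))) /=.
by apply: eq_bigr => s _; rewrite -(Tsym s) // perm_sym perm_rot.
Qed.

End TensorAlgebra.

(** Otherwise P would vanish at l m for infinitely many m, hence at more distinct points than its
    degree allows. *)
Lemma poly_inj_eventually_neq0 (F : idomainType) (P : {poly F}) (l : nat -> F) :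
  injective l -> P != 0 ->
  exists N, forall m, (N <= m)%N -> P.[l m] != 0.
Proof.
move=> linj PN0; apply: contrapT => /forallNP noN.
have many c : exists s : seq nat,
    [/\ uniq s, size s = c & all (root P) [seq l i | i <- s]].
  elim: c => [|c [s [us szs rs]]]; first by exists [::].
  have /existsNP[m /not_implyP[lem /negP/negPn rm]] :=
    noN (\max_(i <- s) i).+1.
  exists (m :: s); split; rewrite /= ?szs ?us ?andbT //; last exact/andP.
  apply/negP => ms; move: lem; rewrite ltnNge => /negP; apply.
  exact: leq_bigmax_seq.
have [s [us szs rs]] := many (size P).
have := max_poly_roots PN0 rs.
by rewrite (map_inj_uniq linj) us size_map szs ltnn => /(_ isT).
Qed.

Lemma gform_morph (A A' : comNzRingType) (phi : {rmorphism A -> A'}) k n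
    (T : k.-tuple 'I_n -> A) x :
  phi (gform T x) = gform (phi \o T) (phi \o x).
Proof.
rewrite rmorph_sum; apply: eq_bigr => s _.
by rewrite rmorphM rmorph_prod.
Qed.

Lemma gvec_morph (A A' : comNzRingType) (phi : {rmorphism A -> A'}) k n
    (T : k.-tuple 'I_n -> A) x i :
  phi (gvec T x i) = gvec (phi \o T) (phi \o x) i.
Proof.
rewrite rmorph_sum; apply: eq_bigr => s _.
by rewrite rmorphM rmorph_prod.
Qed.

Lemma tvecE (R : realType) k n (T : tensor R k n) x i :
  tvec T x i 0 = gvec T (x^~ 0) i.
Proof. by rewrite mxE. Qed.

Lemma gform_fun (R : realType) k n (T : tensor R k n) (x : nat -> 'cV[R]_n) :
  gform (fun s => cst (T s)) (fun i m => x m i 0) = (fun m => tform T (x m)).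
Proof.
rewrite /gform fct_sumE; apply/funext => m; apply: eq_bigr => s _.
by rewrite fct_prodE.
Qed.

Lemma gvec_fun (R : realType) k n (T : tensor R k n) (x : nat -> 'cV[R]_n) i :
  gvec (fun s => cst (T s)) (fun i m => x m i 0) i
  = (fun m => tvec T (x m) i 0).
Proof.
rewrite /gvec fct_sumE; apply/funext => m; rewrite mxE; apply: eq_bigr => s _.
by rewrite fct_prodE.
Qed.

Lemma graph_gform (K : fieldType) (D : K -> K -> Prop) k n
    (T : k.-tuple 'I_n -> K) x u :
  derivation_graph D -> (forall s, D (T s) 0) -> (forall i, D (x i) (u i)) ->
  D (gform T x) (\sum_s T s * prod_diff x u s).
Proof.
move=> gD DT Dx; apply: graph_sum => // s _.
rewrite -[_ * prod_diff _ _ _]add0r -{1}[0](mul0r (\prod_(j <- s) x j)).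
apply: graphM => //; elim: (tval s) => [|a t IH] /=.
  by rewrite big_nil; exact: graph1.
by rewrite big_cons; apply: graphM.
Qed.

Lemma derivation_extension_family (K : fieldType) (D : K -> K -> Prop)
    (n : nat) (x : 'I_n -> K) :
  [pchar K] =i pred0 -> derivation_graph D ->
  exists D' : K -> K -> Prop,
    [/\ derivation_graph D', (forall a a', D a a' -> D' a a')
      & exists u, forall i, D' (x i) (u i)].
Proof.
move=> char0 gD.
have [D' [gD' sD' hD']] : exists D' : K -> K -> Prop,
    [/\ derivation_graph D', (forall a a', D a a' -> D' a a')
      & forall i, i \in enum 'I_n -> exists u, D' (x i) u].
  elim: (enum 'I_n) => [|i s [D1 [g1 s1 h1]]]; first by exists D.
  have [D2 [g2 s2 h2]] := derivation_extension g1 (x i) char0.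
  exists D2; split=> // [a a' /s1/s2 //|j].
  by rewrite inE => /orP[/eqP -> //|/h1[u /s2]]; exists u.
exists D'; split=> //.
have /choice[u hu] : forall i, exists u, D' (x i) u.
  by move=> i; apply: hD'; rewrite mem_enum.
by exists u.
Qed.

(* Given infinitely many eigenvalues, an ultrapower K of R contains an
   eigenpair (x, l) with l transcendental over R. The derivation d/dl of R(l)
   extends to K(x), and applied to T x^k = l B x^k it yields B x^k = 0. *)
Lemma finite_eigenvalues (R : realType) k n (T B : tensor R k n) :
  (0 < k)%N -> symmetric_tensor T -> symmetric_tensor B ->
  positive_definite B -> finite_set [set lam | is_eigenvalue T B lam].
Proof.
move=> k_gt0 Tsym Bsym Bpd; apply: contrapT.
move=> /infiniteP/pcard_leP/unsquash l_.
have [l linj eigl] : exists2 l : nat -> R, injective l &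
    forall m, is_eigenvalue T B (l m).
  exists l_ => [i j|m]; first by apply: inj; rewrite inE.
  exact: funS.
have /choice[x hx] : forall m, exists x : 'cV[R]_n,
    x != 0 /\ tvec T x = l m *: tvec B x.
  by move=> m; have [x ? ?] := eigl m; exists x.
have [K [phi phiN0]] := exists_ultrapower R.
have char0 : [pchar K] =i pred0.
  apply/pcharf0P => -[|m]; first by rewrite mulr0n !eqxx.
  apply/negbTE; rewrite -(rmorph_nat phi); apply: (phiN0 _ 0%N) => j _.
  rewrite (_ : (m.+1%:R : nat -> R) = cst m.+1%:R) ?pnatr_eq0 //.
  elim: m.+1 => // i IH; rewrite -natr1 IH.
  by apply/funext => j'; rewrite -[RHS]natr1.
pose iota (c : R) : K := phi (cst c).
(* The zero derivation on the copy of [R] in [K], to be extended first to [lam] with value 1 and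
   then to the coordinates of the eigenvector. *)
pose D0 a a' := (exists c, a = iota c) /\ a' = 0 :> K.
have gD0 : derivation_graph D0.
  split.
  - by split=> //; exists 1; rewrite -(rmorph1 phi).
  - move=> _ _ _ _ [[c ->] ->] [[c' ->] ->]; split; last by rewrite subrr.
    by exists (c - c'); rewrite -rmorphB.
  - move=> _ _ _ _ [[c ->] ->] [[c' ->] ->].
    split; last by rewrite mul0r mulr0 addr0.
    by exists (c * c'); rewrite -rmorphM.
  - by move=> _ [_ ->].
pose lam := phi l.
(* [lam] is transcendental over [R]: it is the class of an injective sequence, along which a nonzero
   real polynomial is eventually nonzero. *)
have tr p q : poly_graph D0 p q -> p.[lam] = 0 -> p = 0.
  move=> hpq; have /choice[c hc] : forall i, exists c, p`_i = iota c.
    by move=> i; have [[c ?] _] := hpq i; exists c.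
  pose P := \poly_(i < size p) c i.
  have -> : p.[lam] = phi (fun m => P.[l m]).
    rewrite horner_coef (_ : (fun m => P.[l m]) =
      \sum_(i < size p) cst (c i) * l ^+ i :> (nat -> R)).
      by rewrite rmorph_sum; apply: eq_bigr => i _; rewrite rmorphM rmorphXn hc.
    rewrite fct_sumE; apply/funext => m; rewrite horner_poly.
    apply: eq_bigr => i _; rewrite -[RHS]/(c i * (l ^+ i) m); congr (_ * _).
    by elim: (val i) => // j IH; rewrite !exprS IH.
  move=> phiP0; apply: contrapT => /eqP pN0.
  have PN0 : P != 0.
    apply/eqP => /polyP/(_ (size p).-1); rewrite coef_poly coef0.
    rewrite prednK ?size_poly_gt0 // leqnn => c0.
    move: pN0; rewrite -lead_coef_eq0 lead_coefE hc c0.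
    by rewrite -[iota 0]/(phi 0) rmorph0 eqxx.
  have [N PN] := poly_inj_eventually_neq0 linj PN0.
  by have := phiN0 _ N PN; rewrite phiP0 eqxx.
have gD1 := adjoin_transcendental gD0 1 tr.
pose X i := phi (fun m => x m i 0).
have [D [gD sD [u hu]]] := derivation_extension_family X char0 gD1.
have Diota c : D (iota c) 0.
  by apply/sD/adjoin_graph_sub => //; split=> //; exists c.
have Dlam : D lam 1 by apply/sD/adjoin_graph_gen.
have DT := graph_gform gD (fun s => Diota (T s)) hu.
have DB := graph_gform gD (fun s => Diota (B s)) hu.
have vecE i : gvec (iota \o T) X i = lam * gvec (iota \o B) X i.
  rewrite -[gvec (_ \o T) X i](gvec_morph phi (fun s => cst (T s))
    (fun i m => x m i 0)).
  rewrite -[gvec (_ \o B) X i](gvec_morph phi (fun s => cst (B s))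
    (fun i m => x m i 0)).
  rewrite -rmorphM !gvec_fun; congr (phi _); apply/funext => m.
  by rewrite (hx m).2 mxE.
have formE : gform (iota \o T) X = lam * gform (iota \o B) X.
  rewrite -!gform_euler // mulr_sumr; apply: eq_bigr => i _.
  by rewrite vecE mulrCA.
have formB : gform (iota \o B) X != 0.
  rewrite -[gform _ X](gform_morph phi (fun s => cst (B s))
    (fun i m => x m i 0)).
  apply: (phiN0 _ 0%N) => m _; rewrite gform_fun.
  by rewrite gt_eqF // Bpd // (hx m).1.
(* T X^k = lam B X^k receives two derivatives, the second with the extra term 1 * B X^k. By the
   eigenvalue equation the remaining sums coincide, so B X^k = 0, against [formB]. *)
have := graph_inj gD DT; rewrite formE => /(_ _ (graphM gD Dlam DB)).
rewrite !sum_prod_diff => [|s t st|s t st]; last 2 first.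
- by congr (iota _); exact: Bsym.
- by congr (iota _); exact: Tsym.
under eq_bigr do rewrite vecE mulrCA.
rewrite -mulr_sumr mulrCA -[LHS]add0r => /addIr /esym /eqP.
by rewrite mul1r (negPf formB).
Qed.

(** * The merit function on the sphere *)

Section Euclidean.
Variables (R : realType) (n : nat).
Implicit Types (u v w : 'cV[R]_n) (a : R).

Lemma dotE u v : dot u v = \sum_i u i 0 * v i 0.
Proof. by rewrite /dot mxE; apply: eq_bigr => i _; rewrite mxE. Qed.

Lemma dotC u v : dot u v = dot v u.
Proof. by rewrite !dotE; apply: eq_bigr => i _; rewrite mulrC. Qed.

Lemma dotDl u v w : dot (u + v) w = dot u w + dot v w.
Proof. by rewrite /dot linearD mulmxDl mxE. Qed.

Lemma dotDr u v w : dot u (v + w) = dot u v + dot u w.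
Proof. by rewrite dotC dotDl !(dotC u). Qed.

Lemma dotZl a u v : dot (a *: u) v = a * dot u v.
Proof. by rewrite /dot linearZ -scalemxAl mxE. Qed.

Lemma dotZr a u v : dot u (a *: v) = a * dot u v.
Proof. by rewrite dotC dotZl dotC. Qed.

Lemma dotNl u v : dot (- u) v = - dot u v.
Proof. by rewrite -scaleN1r dotZl mulN1r. Qed.

Lemma dotNr u v : dot u (- v) = - dot u v.
Proof. by rewrite dotC dotNl dotC. Qed.

Lemma dot_ge0 u : 0 <= dot u u.
Proof. by rewrite dotE; apply: sumr_ge0 => i _; rewrite -expr2 sqr_ge0. Qed.

Lemma dot_eq0 u : (dot u u == 0) = (u == 0).
Proof.
apply/idP/idP => [|/eqP ->]; last first.
  by rewrite -[0 : 'cV_n](scale0r 0) dotZl mul0r.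
rewrite dotE psumr_eq0 => [/allP h|i _]; last by rewrite -expr2 sqr_ge0.
apply/eqP/colP => i; rewrite mxE; apply/eqP.
by have := h i (mem_index_enum i); rewrite mulf_eq0 orbb.
Qed.

Lemma dot_mull (A : 'M[R]_n) u v : dot (A *m u) v = dot u (A^T *m v).
Proof. by rewrite /dot trmx_mul mulmxA. Qed.

Lemma enorm_ge0 u : 0 <= enorm u.
Proof. exact: sqrtr_ge0. Qed.

Lemma enorm_sqr u : enorm u ^+ 2 = dot u u.
Proof. by rewrite sqr_sqrtr ?dot_ge0. Qed.

Lemma enorm_eq0 u : (enorm u == 0) = (u == 0).
Proof. by rewrite -dot_eq0 -enorm_sqr sqrf_eq0. Qed.

Lemma enormZ a u : enorm (a *: u) = `|a| * enorm u.
Proof.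
by rewrite /enorm dotZl dotZr mulrA -expr2 sqrtrM ?sqr_ge0 // sqrtr_sqr.
Qed.

Lemma enormN u : enorm (- u) = enorm u.
Proof. by rewrite /enorm dotNl dotNr opprK. Qed.

Lemma dot_le_enorm u v : `|dot u v| <= enorm u * enorm v.
Proof.
rewrite -ler_sqr ?nnegrE ?mulr_ge0 ?enorm_ge0 //.
rewrite exprMn !enorm_sqr real_normK ?num_real //.
have [v0|vN0] := eqVneq (dot v v) 0.
  move/eqP: v0; rewrite dot_eq0 => /eqP ->.
  by rewrite -[0 : 'cV_n](scale0r 0) dotZr mul0r expr2 !mul0r dotZr mul0r mulr0.
have vpos : 0 < dot v v by rewrite lt_def vN0 dot_ge0.
have := dot_ge0 (dot v v *: u - dot u v *: v).
rewrite !(dotDl, dotDr, dotNl, dotNr, dotZl, dotZr) (dotC v u) => h.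
rewrite -subr_ge0 -(pmulr_rge0 _ vpos); apply: le_trans h _.
by rewrite le_eqVlt; apply/orP; left; apply/eqP; ring.
Qed.

Lemma enormD u v : enorm (u + v) <= enorm u + enorm v.
Proof.
rewrite -ler_sqr ?nnegrE ?addr_ge0 ?enorm_ge0 // enorm_sqr sqrrD !enorm_sqr.
rewrite !(dotDl, dotDr) (dotC v u).
have := le_trans (ler_norm _) (dot_le_enorm u v); lra.
Qed.

Lemma enormB u v : enorm (u - v) <= enorm u + enorm v.
Proof. by rewrite (le_trans (enormD _ _)) ?enormN. Qed.

Lemma coord_le_enorm u i : `|u i 0| <= enorm u.
Proof.
rewrite -ler_sqr ?nnegrE ?enorm_ge0 // enorm_sqr real_normK ?num_real //.
rewrite dotE (bigD1 i) //= expr2 lerDl.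
by apply: sumr_ge0 => j _; rewrite -expr2 sqr_ge0.
Qed.

Lemma unit_sphere_dot u : unit_sphere u <-> dot u u = 1.
Proof.
rewrite -enorm_sqr; split=> [->|/eqP]; first by rewrite expr1n.
by rewrite sqrp_eq1 ?enorm_ge0 // => /eqP.
Qed.

Lemma unit_sphere_neq0 u : unit_sphere u -> u != 0.
Proof. by rewrite -enorm_eq0 => ->; rewrite oner_eq0. Qed.

Lemma normalize_unit_sphere u : u != 0 -> unit_sphere ((enorm u)^-1 *: u).
Proof.
rewrite -enorm_eq0 => uN0; rewrite /unit_sphere /= enormZ.
by rewrite ger0_norm ?invr_ge0 ?enorm_ge0 // mulVf.
Qed.

End Euclidean.

(** A perturbed factor is at most 1 + 2 = 3 in absolute value, 2 being the diameter of the sphere.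
    The first-order bound is proved along with the second because the induction for the latter uses
    it. *)
Lemma prod_taylor (R : realType) (I : Type) (x d : I -> R) (e : R) (s : seq I) :
  0 <= e <= 2 -> (forall i, `|x i| <= 1) -> (forall i, `|d i| <= e) ->
  `|\prod_(j <- s) (x j + d j) - \prod_(j <- s) x j| <= 3 ^+ size s * e /\
  `|\prod_(j <- s) (x j + d j) - \prod_(j <- s) x j - prod_diff x d s|
    <= 3 ^+ size s * e ^+ 2.
Proof.
move=> /andP[e0 e2] hx hd.
have bound t : `|\prod_(j <- t) (x j + d j)| <= 3 ^+ size t.
  elim: t => [|a t IH]; first by rewrite big_nil normr1.
  rewrite big_cons normrM exprS; apply: ler_pM => //.
  rewrite (le_trans (ler_normD _ _)) //.
  by have := hx a; have := hd a; lra.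
elim: s => [|a s [IH1 IH2]].
  by rewrite !big_nil /= subrr subr0 normr0; split; rewrite mul1r ?sqr_ge0.
rewrite !big_cons /=; set P' := \prod_(j <- s) _ in IH1 IH2 *.
set P := \prod_(j <- s) x j in IH1 IH2 *; set c := 3 ^+ size s in IH1 IH2 *.
have P'c : `|P'| <= c := bound s.
have c0 : 0 <= c by rewrite exprn_ge0.
split.
  have -> : (x a + d a) * P' - x a * P = x a * (P' - P) + d a * P' by ring.
  rewrite (le_trans (ler_normD _ _)) // !normrM exprS -/c.
  have h1 := ler_pM (normr_ge0 _) (normr_ge0 _) (hx a) IH1.
  have h2 := ler_pM (normr_ge0 _) (normr_ge0 _) (hd a) P'c.
  have := mulr_ge0 c0 e0; lra.
have -> : (x a + d a) * P' - x a * P - (d a * P + x a * prod_diff x d s) =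
   x a * (P' - P - prod_diff x d s) + d a * (P' - P) by ring.
rewrite (le_trans (ler_normD _ _)) // !normrM exprS -/c.
have h1 := ler_pM (normr_ge0 _) (normr_ge0 _) (hx a) IH2.
have h2 := ler_pM (normr_ge0 _) (normr_ge0 _) (hd a) IH1.
have := mulr_ge0 c0 (sqr_ge0 e); rewrite expr2 in h1 h2 *; lra.
Qed.

Section TensorForms.
Variables (R : realType) (k n : nat).
Implicit Types (T B : tensor R k n) (x y d : 'cV[R]_n).

Lemma dot_tvec T x d : dot (tvec T x) d = \sum_i d i 0 * gvec T (x^~ 0) i.
Proof. by rewrite dotE; apply: eq_bigr => i _; rewrite tvecE mulrC. Qed.

Lemma tform_euler T x : (0 < k)%N -> dot (tvec T x) x = tform T x.
Proof. by move=> k_gt0; rewrite dot_tvec gform_euler. Qed.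

Lemma tform_taylor T : symmetric_tensor T -> exists2 C : R, 0 <= C &
  forall x d, enorm x <= 1 -> enorm d <= 2 ->
  `|tform T (x + d) - tform T x| <= C * enorm d /\
  `|tform T (x + d) - tform T x - k%:R * dot (tvec T x) d|
    <= C * enorm d ^+ 2.
Proof.
move=> Tsym; exists (\sum_s `|T s| * 3 ^+ k).
  by apply: sumr_ge0 => s _; rewrite mulr_ge0 ?exprn_ge0.
move=> x d x1 d2.
have e02 : 0 <= enorm d <= 2 by rewrite enorm_ge0.
have hs (s : k.-tuple 'I_n) := prod_taylor s e02
  (fun i => le_trans (coord_le_enorm x i) x1) (coord_le_enorm d).
have formD : tform T (x + d) = \sum_s T s * \prod_(j <- s) (x j 0 + d j 0).
  by apply: eq_bigr => s _; congr (_ * _); apply: eq_bigr => j _; rewrite mxE.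
rewrite dot_tvec -(@sum_prod_diff R k n T) // formD /tform -!sumrB.
split; rewrite (le_trans (ler_norm_sum _ _ _)) // mulr_suml;
  apply: ler_sum => s _; have [h1 h2] := hs s; rewrite size_tuple in h1 h2.
  by rewrite -mulrBr normrM -mulrA ler_wpM2l.
by rewrite -!mulrBr normrM -mulrA ler_wpM2l.
Qed.

Lemma tformZ T a x : tform T (a *: x) = a ^+ k * tform T x.
Proof.
rewrite /tform mulr_sumr; apply: eq_bigr => s _.
rewrite (eq_bigr (fun j => a * x j 0)) => [|j _]; last by rewrite mxE.
rewrite big_split /= big_const_seq count_predT size_tuple iter_mulr mulr1.
by rewrite mulrCA.
Qed.

Lemma tformB T B a x : tform (T - a *: B) x = tform T x - a * tform B x.
Proof.
rewrite /tform mulr_sumr -sumrB; apply: eq_bigr => s _.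
by rewrite !ffunE -[_ *: _]/(a * B s); ring.
Qed.

Lemma tvecB T B a x : tvec (T - a *: B) x = tvec T x - a *: tvec B x.
Proof.
apply/colP => i; rewrite !mxE mulr_sumr -sumrB; apply: eq_bigr => s _.
by rewrite !ffunE -[_ *: _]/(a * B s); ring.
Qed.

Lemma symmetric_tensorB T B a : symmetric_tensor T -> symmetric_tensor B ->
  symmetric_tensor (T - a *: B).
Proof. by move=> hT hB s t st; rewrite !ffunE (hT _ _ st) (hB _ _ st). Qed.

Lemma meritZ T B a x : a != 0 -> merit T B (a *: x) = merit T B x.
Proof.
move=> a0; rewrite /merit !tformZ invfM mulrACA divff ?mul1r //.
by rewrite expf_neq0.
Qed.

Lemma eigenvalue_merit T B lam x : (0 < k)%N -> tform B x != 0 ->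
  tvec T x = lam *: tvec B x -> merit T B x = lam /\ merit_grad T B x = 0.
Proof.
move=> k_gt0 Bx h; have e : tform T x = lam * tform B x.
  by rewrite -!tform_euler // h dotZl.
have m : tform T x / tform B x = lam by rewrite e mulfK.
by rewrite /merit /merit_grad m h subrr scaler0.
Qed.

Lemma merit_grad_eigenvalue T B x : (0 < k)%N -> tform B x != 0 ->
  merit_grad T B x = 0 -> tvec T x = merit T B x *: tvec B x.
Proof.
move=> k_gt0 Bx /eqP; rewrite /merit_grad scaler_eq0 mulf_eq0 invr_eq0.
by rewrite (negPf Bx) orbF pnatr_eq0 -leqn0 leqNgt k_gt0 /= subr_eq0 => /eqP.
Qed.

(** f is homogeneous of degree 0, hence constant along rays, so its gradient is tangent to the
    sphere. *)
Lemma dot_merit_grad T B x : (0 < k)%N -> tform B x != 0 ->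
  dot (merit_grad T B x) x = 0.
Proof.
move=> k_gt0 Bx; rewrite dotZl dotDl dotNl dotZl !tform_euler //.
by rewrite divfK // subrr mulr0.
Qed.

End TensorForms.

Lemma continuous_mx (R : numFieldType) (S : topologicalType) m n
    (f : S -> 'M[R]_(m, n)) (h : 'I_m -> 'I_n -> S -> R) x :
  (forall i j y, f y i j = h i j y) ->
  (forall i j, {for x, continuous (h i j)}) -> {for x, continuous f}.
Proof.
move=> fh ch A [P MP sPA]; rewrite /= nbhs_filterE.
have : \forall y \near x, forall i j, P i j (h i j y).
  apply: filter_forall => i; apply: filter_forall => j.
  by apply: (ch i j); rewrite -fh; exact: (MP i j).
by apply: filterS => y hy; apply: sPA => i j; rewrite fh.
Qed.

Section SphereTopology.
Variables (R : realType) (n : nat).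
Implicit Types (x y : 'cV[R]_n) (f : 'cV[R]_n -> R).

Lemma continuous_tform k (T : tensor R k n) : continuous (tform T).
Proof.
apply: continuous_big => [|s _ x]; first exact: add_continuous.
apply: continuousM; first exact: cst_continuous.
apply: continuous_big => [|j _]; first exact: mul_continuous.
exact: coord_continuous.
Qed.

Lemma continuous_tvec k (T : tensor R k n) : continuous (tvec T).
Proof.
move=> x; apply: (continuous_mx (fun i j y => mxE _ _ _ _)) => i j.
move: x; apply: continuous_big => [|s _ x]; first exact: add_continuous.
apply: continuousM; first exact: cst_continuous.
apply: continuous_big => [|l _]; first exact: mul_continuous.
exact: coord_continuous.
Qed.

Lemma continuous_sqr_enorm : continuous (fun x : 'cV[R]_n => dot x x).
Proof.
rewrite (_ : (fun x => _) = fun x : 'cV_n => \sum_i x i 0 * x i 0); last first.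
  by apply/funext => x; rewrite dotE.
apply: continuous_big => [|i _ x]; first exact: add_continuous.
by apply: continuousM; exact: coord_continuous.
Qed.

Lemma continuous_enorm : continuous (@enorm R n).
Proof.
move=> x.
exact: (continuous_comp (@continuous_sqr_enorm x) (@sqrt_continuous R _)).
Qed.

Lemma compact_unit_sphere : compact (@unit_sphere R n).
Proof.
(* The sphere is a closed subset of the cube [-1,1]^n, carried from row vectors to column vectors by
   transposition. *)
have cbox := @rV_compact R n (fun=> `[-1, 1]%classic)
  (fun=> @segment_compact R _ _).
have ctr : continuous (fun v : 'rV[R]_n => v^T).
  move=> v; apply: (@continuous_mx _ _ _ _ _
    (fun i j (w : 'rV[R]_n) => w j i)) => [i j w|i j].
    by rewrite mxE.
  exact: coord_continuous.
have cimg := continuous_compact (continuous_subspaceT ctr) cbox.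
apply: (subclosed_compact _ cimg).
  have /continuous_closedP ecl := continuous_enorm.
  exact: (ecl _ (@closed_eq R 1)).
move=> x xS; exists x^T; last exact: trmxK.
move=> i /=; rewrite mxE in_itv /= -ler_norml.
by rewrite (le_trans (coord_le_enorm x i)) // xS.
Qed.

Lemma unit_sphere_nonempty : (0 < n)%N -> @unit_sphere R n !=set0.
Proof.
move=> n_gt0; exists (delta_mx (Ordinal n_gt0) 0); apply/unit_sphere_dot.
rewrite dotE (bigD1 (Ordinal n_gt0)) //= big1 => [|i iN].
  by rewrite !mxE !eqxx mulr1 addr0.
by rewrite mxE (negPf iN) mul0r.
Qed.

Lemma sphere_min f : (0 < n)%N ->
  (forall x, unit_sphere x -> {for x, continuous f}) ->
  exists2 x, unit_sphere x & forall y, unit_sphere y -> f x <= f y.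
Proof.
move=> n_gt0 cf.
have [|x xS hx] := compact_EVT_min (unit_sphere_nonempty n_gt0)
    compact_unit_sphere (f := f).
  by apply: continuous_in_subspaceT => x /set_mem; exact: cf.
exists x; first exact: set_mem.
by move=> y yS; apply: hx; exact: mem_set.
Qed.

Lemma sphere_bounded f : (0 < n)%N ->
  (forall x, unit_sphere x -> {for x, continuous f}) ->
  exists2 M, 0 < M & forall x, unit_sphere x -> `|f x| <= M.
Proof.
move=> n_gt0 cf.
have [x xS hx] := sphere_min (f := fun x => - `|f x|) n_gt0
  (fun x xS => continuousN
    (continuous_comp (cf x xS) (@norm_continuous _ _ _))).
exists (`|f x| + 1) => [|y yS]; first by rewrite ltr_wpDl.
by have := hx y yS; rewrite lerN2 => /le_trans; apply; rewrite lerDl.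
Qed.

End SphereTopology.

(** * The merit function and its second-order estimate *)

Section Merit.
Variables (R : realType) (k n : nat) (T B : tensor R k n).
Hypotheses (k_gt0 : (0 < k)%N) (n_gt0 : (0 < n)%N).
Hypotheses (Tsym : symmetric_tensor T) (Bsym : symmetric_tensor B).
Hypothesis Bpd : positive_definite B.
Local Notation f := (merit T B).
Local Notation g := (merit_grad T B).

Lemma tform_gt0 x : unit_sphere x -> 0 < tform B x.
Proof. by move=> /unit_sphere_neq0; exact: Bpd. Qed.

Lemma continuous_merit x : unit_sphere x -> {for x, continuous f}.
Proof.
move=> xS; apply: continuousM; first exact: continuous_tform.
by apply: continuousV; [rewrite gt_eqF ?tform_gt0|exact: continuous_tform].
Qed.

Lemma continuous_merit_grad x : unit_sphere x -> {for x, continuous g}.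
Proof.
move=> xS; apply: continuousZ.
  apply: continuousM; first exact: cst_continuous.
  by apply: continuousV; [rewrite gt_eqF ?tform_gt0|exact: continuous_tform].
apply: continuousB; first exact: continuous_tvec.
by apply: continuousZ; [exact: continuous_merit|exact: continuous_tvec].
Qed.

Lemma merit_grad_bounded :
  exists2 M, 0 < M & forall x, unit_sphere x -> enorm (g x) <= M.
Proof.
have [|M M0 hM] := @sphere_bounded R n (fun x => enorm (g x)) n_gt0.
  move=> x xS; apply: continuous_comp; first exact: continuous_merit_grad.
  exact: continuous_enorm.
by exists M => // x /hM; exact/le_trans/ler_norm.
Qed.

(** The chord from x to y leaves the sphere and may pass through 0, where the quotient is singular.
    So the polynomials T x^k and B x^k are expanded instead of f, and the result is divided by B
    y^k, which is at least its minimum b > 0 on the sphere. *)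
Lemma merit_taylor : exists2 C, 0 < C & forall x y,
  unit_sphere x -> unit_sphere y ->
  f y <= f x + dot (g x) (y - x) + C * enorm (y - x) ^+ 2.
Proof.
have [x0 x0S hb] := sphere_min n_gt0 (fun x (_ : unit_sphere x) =>
  @continuous_tform R n k B x).
set b := tform B x0 in hb; have b_gt0 : 0 < b by exact: tform_gt0.
have [M M0 hM] := sphere_bounded n_gt0 continuous_merit.
have [Mg Mg0 hMg] := merit_grad_bounded.
have [CT CT0 hCT] := tform_taylor Tsym; have [CB CB0 hCB] := tform_taylor Bsym.
exists (((CT + M * CB) + CB * Mg) / b + 1) => [|x y xS yS].
  by rewrite ltr_wpDl // divr_ge0 ?(ltW b_gt0) // !addr_ge0 // mulr_ge0 // ltW.
have yE : y = x + (y - x) by rewrite addrCA subrr addr0.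
set d := y - x in yE *.
have x1 : enorm x <= 1 by rewrite xS.
have d2 : enorm d <= 2.
  by rewrite (le_trans (enormB _ _)) // xS yS; lra.
have [hT1 hT2] := hCT x d x1 d2; have [hB1 hB2] := hCB x d x1 d2.
rewrite -yE in hT1 hT2 hB1 hB2.
have By := tform_gt0 yS; have Bx := tform_gt0 xS.
set e := enorm d in hT1 hT2 hB1 hB2 d2 *; have e0 : 0 <= e := enorm_ge0 d.
have fx : tform T x = f x * tform B x by rewrite /merit divfK // gt_eqF.
have fy : tform T y = f y * tform B y by rewrite /merit divfK // gt_eqF.
have gd : tform B x * dot (g x) d =
    k%:R * dot (tvec T x) d - f x * (k%:R * dot (tvec B x) d).
  rewrite /merit_grad dotZl dotDl dotNl dotZl -/(merit T B x).
  by field; rewrite gt_eqF.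
have gde : `|dot (g x) d| <= Mg * e.
  by rewrite (le_trans (dot_le_enorm _ _)) // ler_wpM2r // hMg.
set r := tform T y - tform T x - k%:R * dot (tvec T x) d in hT2.
set q := tform B y - tform B x - k%:R * dot (tvec B x) d in hB2.
(* Every term on the right is of second order: r and q are Taylor remainders, and the last term is a
   product of two first-order quantities. *)
have key : (f y - f x - dot (g x) d) * tform B y =
    r - f x * q - (tform B y - tform B x) * dot (g x) d.
  have -> : r - f x * q = (f y - f x) * tform B y - tform B x * dot (g x) d.
    by rewrite gd /r /q fx fy; ring.
  by ring.
have bound : (f y - f x - dot (g x) d) * tform B y <=
    ((CT + M * CB) + CB * Mg) * e ^+ 2.
  rewrite key (le_trans (ler_norm _)) // (le_trans (ler_normB _ _)) //.
  have h1 : `|r - f x * q| <= CT * e ^+ 2 + M * (CB * e ^+ 2).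
    rewrite (le_trans (ler_normB _ _)) // lerD // normrM ler_pM //.
    exact: hM.
  have h2 : `|(tform B y - tform B x) * dot (g x) d| <= (CB * e) * (Mg * e).
    by rewrite normrM ler_pM.
  rewrite expr2 in h1 *; lra.
set c := (CT + M * CB) + CB * Mg in bound *.
have c0 : 0 <= c by rewrite /c !addr_ge0 // mulr_ge0 // ltW.
have h : f y - f x - dot (g x) d <= c / b * e ^+ 2.
  rewrite mulrAC ler_pdivlMr //.
  have [X0|X0] := lerP (f y - f x - dot (g x) d) 0.
    by rewrite (@le_trans _ _ 0) ?mulr_ge0 ?sqr_ge0 // mulr_le0_ge0 // ltW.
  exact: le_trans (ler_wpM2l (ltW X0) (hb y yS)) bound.
have := sqr_ge0 e; lra.
Qed.

End Merit.

(** * L-BFGS matrices *)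

Section Lbfgs.
Variables (R : realType) (n : nat).
Implicit Types (u v w y s z : 'cV[R]_n) (H V : 'M[R]_n).

Lemma outer_mul u v w : (u *m v^T) *m w = dot v w *: u.
Proof. by rewrite -mulmxA [v^T *m w]mx11_scalar mul_mx_scalar. Qed.

Definition spectral_bounds (m M : R) H : Prop :=
  forall z, m * enorm z ^+ 2 <= dot z (H *m z) /\ enorm (H *m z) <= M * enorm z.

Lemma spectral_bounds_scalar m M gam :
  0 <= m <= gam -> gam <= M -> spectral_bounds m M gam%:M.
Proof.
move=> /andP[m0 mg] gM z; rewrite mul_scalar_mx dotZr enormZ -enorm_sqr.
rewrite ger0_norm ?(le_trans m0) //.
by split; [rewrite ler_wpM2r ?sqr_ge0|rewrite ler_wpM2r ?enorm_ge0].
Qed.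

(** V alone may be singular: it kills y when r = 1/(y.s). The rank-one term repairs this, since z =
    V z + r (s.z) y: the first part is controlled by the form of H at V z, the second by r (s.z)^2
    because r <= 1/kappa. *)
Lemma spectral_bounds_update (kappa Y m M : R) :
  0 < kappa -> 0 < Y -> 0 < m -> 0 < M ->
  exists m' M', [/\ 0 < m', 0 < M' &
    forall (r : R) y s H, 0 <= r <= kappa^-1 -> enorm y <= Y -> enorm s <= 2 ->
      spectral_bounds m M H ->
      spectral_bounds m' M'
        ((1%:M - r *: (y *m s^T))^T *m H *m (1%:M - r *: (y *m s^T))
         + r *: (s *m s^T))].
Proof.
move=> kappa0 Y0 m0 M0.
pose c := 2 / m + 2 * kappa^-1 * Y ^+ 2.
pose v := 1 + kappa^-1 * Y * 2.
have k0 : 0 < kappa^-1 by rewrite invr_gt0.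
have c0 : 0 < c.
  by rewrite ltr_pwDl ?divr_gt0 // mulr_ge0 ?sqr_ge0 // mulr_ge0 // ltW.
have v0 : 0 < v by rewrite ltr_pwDl // !mulr_ge0 // ltW.
exists c^-1, (v * (M * v) + kappa^-1 * 4); split.
- by rewrite invr_gt0.
- by rewrite addr_gt0 // !mulr_gt0.
move=> r y s H /andP[r0 rk] hy hs hH z.
set V := 1%:M - _.
have Vz w : V *m w = w - (r * dot s w) *: y.
  by rewrite mulmxBl mul1mx -scalemxAl outer_mul scalerA.
have VTz w : V^T *m w = w - (r * dot y w) *: s.
  rewrite linearB linearZ /= trmx1 trmx_mul trmxK.
  by rewrite mulmxBl mul1mx -scalemxAl outer_mul scalerA.
have y0 := enorm_ge0 y; have s0 := enorm_ge0 s.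
(* Used twice, for V with (a, b) = (s, y) and for its transpose with (a, b) = (y, s). *)
have normV ca cb a b w : 0 <= ca -> ca * cb = 2 * Y ->
    enorm a <= ca -> enorm b <= cb ->
    enorm (w - (r * dot a w) *: b) <= v * enorm w.
  move=> ca0 cab ha hb.
  rewrite (le_trans (enormB _ _)) // enormZ mulrDl mul1r lerD2l.
  rewrite normrM (ger0_norm r0).
  have w0 := enorm_ge0 w; have b0 := enorm_ge0 b.
  have h1 : `|dot a w| <= ca * enorm w.
    by rewrite (le_trans (dot_le_enorm _ _)) // ler_wpM2r.
  have h2 : r * `|dot a w| <= kappa^-1 * (ca * enorm w) by rewrite ler_pM.
  have h3 : r * `|dot a w| * enorm b <= kappa^-1 * (ca * enorm w) * cb.
    by rewrite ler_pM // mulr_ge0.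
  rewrite (le_trans h3) // (_ : _ * cb = kappa^-1 * (ca * cb) * enorm w).
    by rewrite cab (mulrC 2) mulrA.
  by ring.
have [hH1 hH2] := hH (V *m z).
rewrite mulmxDl -scalemxAl outer_mul scalerA -!mulmxA dotDr dotZr.
rewrite (_ : dot z (V^T *m (H *m (V *m z))) = dot (V *m z) (H *m (V *m z)));
  last by rewrite dot_mull.
rewrite (dotC z s).
split.
  rewrite mulrC ler_pdivrMr // mulrC.
  set q := dot (V *m z) _ in hH1 *.
  have zE : z = V *m z + (r * dot s z) *: y by rewrite Vz subrK.
  have h1 : enorm z <= enorm (V *m z) + r * `|dot s z| * Y.
    rewrite {1}zE (le_trans (enormD _ _)) // lerD2l enormZ normrM.
    rewrite (ger0_norm r0).
    by rewrite ler_wpM2l // mulr_ge0.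
  have h2 : enorm z ^+ 2 <= 2 * enorm (V *m z) ^+ 2
      + 2 * (r * `|dot s z| * Y) ^+ 2.
    set A := enorm (V *m z) in h1 *; set D := r * _ * Y in h1 *.
    have : enorm z ^+ 2 <= (A + D) ^+ 2.
      by rewrite ler_sqr ?nnegrE ?enorm_ge0 // (le_trans _ h1) ?enorm_ge0.
    have := sqr_ge0 (A - D); rewrite !expr2; lra.
  apply: (le_trans h2).
  have h3 : enorm (V *m z) ^+ 2 <= q / m by rewrite ler_pdivlMr // mulrC.
  have q0 : 0 <= q by rewrite (le_trans _ hH1) // mulr_ge0 ?sqr_ge0 // ltW.
  have p0 : 0 <= r * dot s z * dot s z.
    by rewrite -mulrA mulr_ge0 // -expr2 sqr_ge0.
  have -> : (r * `|dot s z| * Y) ^+ 2 = r * Y ^+ 2 * (r * dot s z * dot s z).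
    by rewrite !exprMn real_normK ?num_real // !expr2; ring.
  have h4 : r * Y ^+ 2 * (r * dot s z * dot s z) <=
      kappa^-1 * Y ^+ 2 * (r * dot s z * dot s z).
    by rewrite ler_wpM2r // ler_wpM2r ?sqr_ge0.
  (* [c] is the sum of the two coefficients needed; the cross terms left over are nonnegative. *)
  have -> : c * (q + r * dot s z * dot s z) = 2 * (q / m)
     + 2 * (kappa^-1 * Y ^+ 2 * (r * dot s z * dot s z))
     + (2 * kappa^-1 * Y ^+ 2 * q + 2 / m * (r * dot s z * dot s z)).
    by rewrite /c; ring.
  have h5 : 0 <= 2 * kappa^-1 * Y ^+ 2 * q by rewrite !mulr_ge0 ?sqr_ge0 // ltW.
  have h6 : 0 <= 2 / m * (r * dot s z * dot s z).
    by rewrite mulr_ge0 // divr_ge0 // ltW.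
  lra.
have z0 := enorm_ge0 z.
rewrite (le_trans (enormD _ _)) // mulrDl lerD //.
  rewrite VTz (le_trans (normV _ _ _ _ _ (ltW Y0) (mulrC _ _) hy hs)) //.
  rewrite -mulrA ler_wpM2l ?(ltW v0) //.
  rewrite (le_trans hH2) // -mulrA ler_wpM2l ?(ltW M0) // Vz.
  exact: (normV _ _ _ _ _ (ler0n R 2) erefl hs hy).
rewrite enormZ normrM (ger0_norm r0).
have h1 : `|dot s z| <= 2 * enorm z.
  by rewrite (le_trans (dot_le_enorm _ _)) // ler_wpM2r.
have h2 : r * `|dot s z| <= kappa^-1 * (2 * enorm z) by rewrite ler_pM.
have h3 : r * `|dot s z| * enorm s <= kappa^-1 * (2 * enorm z) * 2.
  by rewrite ler_pM // mulr_ge0.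
by rewrite (le_trans h3) // le_eqVlt; apply/orP; left; apply/eqP; ring.
Qed.

Section Bounded.
Variables (g : 'cV[R]_n -> 'cV[R]_n) (kappa M : R).
Hypotheses (kappa0 : 0 < kappa) (M0 : 0 < M).
Hypothesis gM : forall x, unit_sphere x -> enorm (g x) <= M.

Definition sphere_until (x : nat -> 'cV[R]_n) c :=
  forall j, (0 < j <= c)%N -> unit_sphere (x j).

Lemma ydiff_bound x c j : sphere_until x c -> (0 < j < c)%N ->
  enorm (ydiff g x j) <= 2 * M.
Proof.
move=> xS /andP[j0 jc]; rewrite (le_trans (enormB _ _)) // mulr_natl mulr2n.
by apply: lerD; apply/gM/xS; lia.
Qed.

Lemma sdiff_bound x c j : sphere_until x c -> (0 < j < c)%N ->
  enorm (sdiff x j) <= 2.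
Proof.
move=> xS /andP[j0 jc]; rewrite (le_trans (enormB _ _)) //.
have h i : (0 < i <= c)%N -> enorm (x i) = 1 := xS i.
by rewrite !h; [lra|lia|lia].
Qed.

Lemma rho_bound x j : 0 <= rho g kappa x j <= kappa^-1.
Proof.
rewrite /rho; case: ifP => [h|_]; last by rewrite lexx invr_ge0 ltW.
have h0 := lt_le_trans kappa0 h.
by rewrite invr_ge0 (ltW h0) lef_pV2.
Qed.

(** From y.s >= kappa, |y| <= 2M and |s| <= 2, Cauchy-Schwarz gives |y| >= kappa/2 and |s| >=
    kappa/(2M). The minimum [m0] lists the resulting lower bounds of the default 1 and of the three
    quotients; each quotient is at most 4/kappa. *)
Lemma gamma_bound : exists m0 m1, [/\ 0 < m0, 0 < m1 &
  forall x c gam, (0 < c)%N -> sphere_until x c ->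
    gamma_choice g kappa x c gam -> m0 <= gam <= m1].
Proof.
pose m0 := Num.min 1 (Num.min (kappa / (2 * M) ^+ 2)
   (Num.min ((kappa / (2 * M)) ^+ 2 / (4 * M)) (kappa / (2 * M) / (2 * M)))).
pose m1 := Num.max 1 (4 / kappa).
have M2 : 0 < 2 * M by rewrite mulr_gt0.
have M4 : 0 < 4 * M by rewrite mulr_gt0.
exists m0, m1; split.
- rewrite /m0 !lt_min ltr01 !divr_gt0 ?exprn_gt0 ?divr_gt0 //.
- by rewrite /m1 lt_max ltr01.
move=> x c gam c0 xS; rewrite /gamma_choice.
case: ifPn => [_ ->|]; first by rewrite /m0 /m1 ge_min le_max !lexx.
rewrite negb_or -ltnNge -leNgt => /andP[c1 ys].
have jc : (0 < c.-1 < c)%N by lia.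
have hy := ydiff_bound xS jc; have hs := sdiff_bound xS jc.
set y := ydiff g x c.-1 in ys hy *; set s := sdiff x c.-1 in ys hs *.
have yspos := lt_le_trans kappa0 ys.
have ysle := le_trans (ler_norm _) (dot_le_enorm y s).
have y0 := enorm_ge0 y; have s0 := enorm_ge0 s.
have ypos : 0 < enorm y.
  rewrite lt_def y0 andbT; apply/eqP => yz; move: ysle; rewrite yz mul0r; lra.
have spos : 0 < enorm s.
  rewrite lt_def s0 andbT; apply/eqP => yz; move: ysle; rewrite yz mulr0; lra.
have ylow : kappa / 2 <= enorm y.
  rewrite ler_pdivrMr // (le_trans (le_trans ys ysle)) //.
  by rewrite ler_wpM2l.
have slow : kappa / (2 * M) <= enorm s.
  rewrite ler_pdivrMr // (le_trans (le_trans ys ysle)) // mulrC.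
  by rewrite ler_wpM2l.
have ratio : enorm s / enorm y <= 4 / kappa.
  rewrite ler_pdivrMr // mulrAC ler_pdivlMr //.
  have := ler_wpM2r (ltW kappa0) hs; have := ylow; lra.
case=> ->; apply/andP; split.
- rewrite /m0 !ge_min; apply/orP; right; apply/orP; left.
  rewrite ler_pdivrMr ?exprn_gt0 // mulrAC ler_pdivlMr ?exprn_gt0 //.
  rewrite ler_pM // ?(ltW kappa0) ?sqr_ge0 //.
  by rewrite ler_sqr ?nnegrE // ltW.
- rewrite /m1 le_max; apply/orP; right; apply: le_trans ratio.
  rewrite ler_pdivrMr ?exprn_gt0 // expr2 mulrA divfK ?gt_eqF // mulrC.
  by rewrite mulrC (le_trans ysle) // mulrC.
- rewrite /m0 !ge_min; do 2 (apply/orP; right); apply/orP; left.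
  rewrite ler_pM ?divr_ge0 ?sqr_ge0 ?invr_ge0 ?(ltW M4) ?(ltW kappa0)
    ?(ltW M2) //.
    by rewrite ler_sqr ?nnegrE // divr_ge0 // ltW.
  rewrite lef_pV2 ?posrE // (le_trans ysle) //.
  rewrite (_ : 4 * M = 2 * M * 2); last by ring.
  by rewrite ler_pM.
- rewrite /m1 le_max; apply/orP; right.
  have s4 : enorm s ^+ 2 <= 4.
    by rewrite (_ : 4 = 2 ^+ 2) ?ler_sqr ?nnegrE // expr2; lra.
  have := ler_pM (ltW kappa0) (sqr_ge0 _) ys s4.
  by rewrite ler_pdivrMr // mulrAC ler_pdivlMr // mulrC (mulrC 4).
- rewrite /m0 !ge_min; do 3 (apply/orP; right).
  rewrite ler_pM ?divr_ge0 ?invr_ge0 ?(ltW M2) ?(ltW kappa0) //.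
  by rewrite lef_pV2 ?posrE.
- by rewrite /m1 le_max; apply/orP; right.
Qed.

(** At most L updates are applied at every iteration, so the bounds can worsen L times without ever
    depending on [c]. *)
Lemma lbfgs_bound L : exists m M', [/\ 0 < m, 0 < M' &
  forall x c gam, (0 < c)%N -> sphere_until x c ->
    gamma_choice g kappa x c gam ->
    spectral_bounds m M' (lbfgs g kappa L x gam c L)].
Proof.
have aux i : (i <= L)%N -> exists m M', [/\ 0 < m, 0 < M' &
    forall x c gam, (0 < c)%N -> sphere_until x c ->
      gamma_choice g kappa x c gam ->
      spectral_bounds m M' (lbfgs g kappa L x gam c i)].
  elim: i => [_|i IH iL].
    have [m0 [m1 [m00 m10 h]]] := gamma_bound.
    exists m0, m1; split=> // x c gam c0 xS hg.
    have /andP[h1 h2] := h _ _ _ c0 xS hg.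
    by apply: spectral_bounds_scalar; rewrite ?h1 ?(ltW m00).
  have [m [M' [m0 M'0 h]]] := IH (ltnW iL).
  have [m2 [M2 [m20 M20 h2]]] :=
    spectral_bounds_update kappa0 (mulr_gt0 (ltr0n _ 2) M0) m0 M'0.
  exists (Num.min m m2), (Num.max M' M2); split.
  - by rewrite lt_min m0.
  - by rewrite lt_max M'0.
  move=> x c gam c0 xS hg /=.
  have hH := h _ _ _ c0 xS hg.
  have weak mm MM H : (Num.min m m2 <= mm) -> MM <= Num.max M' M2 ->
      spectral_bounds mm MM H ->
      spectral_bounds (Num.min m m2) (Num.max M' M2) H.
    move=> hm hM hb z; have [h3 h4] := hb z; split.
      by rewrite (le_trans _ h3) // ler_wpM2r ?sqr_ge0.
    by rewrite (le_trans h4) // ler_wpM2r ?enorm_ge0.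
  case: ifPn => lc; last by apply: weak hH; rewrite ?ge_min ?le_max lexx.
  (* The strict upper bound needs i < L; it ensures that the pair involves only iterates up to
     [c]. *)
  have jc : (0 < c - (L - i) < c)%N by lia.
  apply: (weak m2 M2); rewrite ?ge_min ?le_max ?lexx ?orbT //.
  apply: h2 => //; first exact: rho_bound.
    exact: ydiff_bound xS jc.
  exact: sdiff_bound xS jc.
exact: aux.
Qed.

End Bounded.
End Lbfgs.

(** * Descent along a run *)

Section Curve.
Variables (R : realType) (n : nat).
Implicit Types (x p g : 'cV[R]_n) (a : R).

Lemma curve_denominator x p a : unit_sphere x ->
  1 <= 1 + enorm (a *: p) ^+ 2 - (a * dot x p) ^+ 2.
Proof.
move=> xS; rewrite -addrA lerDl subr_ge0 -dotZr.
have := dot_le_enorm x (a *: p); rewrite xS mul1r => h.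
by rewrite -[leLHS]real_normK ?num_real // ler_sqr ?nnegrE ?enorm_ge0.
Qed.

(** The curve is a Cayley transform: for |x| = 1 it solves (I + W) z = (I - W) x with the skew
    matrix W = a (x p^T - p x^T). Concretely, the numerator has squared norm D^2. *)
Lemma curve_unit_sphere x p a : unit_sphere x -> unit_sphere (curve x p a).
Proof.
move=> xS; have D1 := curve_denominator p a xS.
apply/unit_sphere_dot; rewrite /curve; set D := _ - _ in D1 *.
have D0 : D != 0 by rewrite gt_eqF // (lt_le_trans ltr01).
have xx : dot x x = 1 by apply/unit_sphere_dot.
set w := _ + _.
have wE : dot w w = D ^+ 2.
  rewrite /w /D !(dotDl, dotDr) !(dotZl, dotZr) enorm_sqr xx (dotC p x).
  by rewrite dotZl dotZr; ring.
by rewrite dotZl dotZr wE; field.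
Qed.

(** With q = a |p| <= 1, the coefficient of x contributes at most 2q + 2q^2 <= 4q and that of p at
    most 2q, whence 6. *)
Lemma curve_dist x p a : unit_sphere x -> 0 <= a -> a * enorm p <= 1 ->
  enorm (curve x p a - x) <= 6 * (a * enorm p).
Proof.
move=> xS a0 ap1; have D1 := curve_denominator p a xS.
have tle : `|a * dot x p| <= a * enorm p.
  rewrite normrM ger0_norm // ler_wpM2l // (le_trans (dot_le_enorm _ _)) //.
  by rewrite xS mul1r.
have bE : enorm (a *: p) = a * enorm p by rewrite enormZ ger0_norm.
rewrite /curve bE; rewrite bE in D1.
set q := a * enorm p in ap1 tle D1 *; set t := a * dot x p in tle D1 *.
set D := 1 + q ^+ 2 - t ^+ 2 in D1 *.
have q0 : 0 <= q by rewrite mulr_ge0 ?enorm_ge0.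
have Dpos : 0 < D by rewrite (lt_le_trans ltr01).
have -> : D^-1 *: (((1 - t) ^+ 2 - q ^+ 2) *: x + (2 * a) *: p) - x =
    (D^-1 * ((1 - t) ^+ 2 - q ^+ 2 - D)) *: x + (D^-1 * (2 * a)) *: p.
  rewrite scalerDr !scalerA [X in _ = X *: _ + _]mulrBr mulVf ?gt_eqF //.
  rewrite scalerBl scale1r.
  by rewrite addrAC.
have D1i : 0 <= D^-1 <= 1 by rewrite invr_ge0 (ltW Dpos) invf_le1.
rewrite (le_trans (enormD _ _)) // !enormZ xS mulr1 !normrM.
have /andP[Di0 Di1] := D1i.
rewrite (ger0_norm Di0) (ger0_norm a0) (ger0_norm (ler0n R 2)).
have h1 : D^-1 * `|(1 - t) ^+ 2 - q ^+ 2 - D| <= 4 * q.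
  rewrite (@le_trans _ _ `|(1 - t) ^+ 2 - q ^+ 2 - D|) ?ler_piMl //.
  rewrite (_ : _ - D = - (2 * t) - 2 * (q ^+ 2 - t ^+ 2)); last first.
    by rewrite /D; ring.
  rewrite (le_trans (ler_normB _ _)) // normrN (normrM 2 t) (normrM 2 (_ - _)).
  rewrite !(ger0_norm (ler0n R 2)).
  have h : 0 <= q ^+ 2 - t ^+ 2.
    by rewrite subr_ge0 -[leLHS]real_normK ?num_real // ler_sqr ?nnegrE.
  rewrite (ger0_norm h).
  have := sqr_ge0 t; have := ler_pM q0 q0 ap1 (lexx q).
  rewrite mul1r; lra.
have h2 : D^-1 * (2 * a) * enorm p <= 2 * q.
  by rewrite -!mulrA -/q ler_piMl // mulr_ge0.
lra.
Qed.

(** As g is orthogonal to x, only the component (2a/D) p counts, and 2/D >= 1 because a |p| <= 1. *)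
Lemma dot_curve x p g a : unit_sphere x -> 0 <= a -> a * enorm p <= 1 ->
  dot g x = 0 -> dot p g <= 0 -> dot g (curve x p a - x) <= a * dot p g.
Proof.
move=> xS a0 ap1 gx pg; have D1 := curve_denominator p a xS.
rewrite dotDr dotNr gx subr0 /curve; set D := _ - _ in D1 *.
rewrite dotZr dotDr !dotZr gx mulr0 add0r (dotC g p).
have D2 : D <= 2.
  rewrite /D enormZ ger0_norm //.
  have h0 : 0 <= a * enorm p by rewrite mulr_ge0 ?enorm_ge0.
  have := ler_pM h0 h0 ap1 ap1; have := sqr_ge0 (a * dot x p).
  rewrite mulr1 -expr2; lra.
have Dpos : 0 < D by rewrite (lt_le_trans ltr01).
have h : 1 <= D^-1 * 2 by rewrite mulrC ler_pdivlMr // mul1r.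
have h' : a * dot p g <= 0 by rewrite mulr_ge0_le0.
have := ler_wnM2r h' h.
by rewrite mul1r -!mulrA.
Qed.

End Curve.

Section Descent.
Variables (R : realType) (k n : nat) (T B : tensor R k n).
Variables (L : nat) (eta beta kappa : R).
Hypotheses (k_gt0 : (0 < k)%N) (n_gt0 : (0 < n)%N).
Hypotheses (Tsym : symmetric_tensor T) (Bsym : symmetric_tensor B).
Hypothesis Bpd : positive_definite B.
Hypotheses (h_eta : 0 < eta < 1) (h_beta : 0 < beta < 1).
Hypothesis kappa_gt0 : 0 < kappa.
Local Notation f := (merit T B).
Local Notation g := (merit_grad T B).

Lemma armijo_small_step (m M : R) : 0 < m -> 0 < M ->
  exists2 a0, 0 < a0 & forall x H a, unit_sphere x -> spectral_bounds m M H ->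
    0 < a <= a0 -> armijo f g eta x (- (H *m g x)) a.
Proof.
move=> m0 M0.
have [Mg Mg0 hMg] := merit_grad_bounded T n_gt0 Bpd.
have [C C0 hC] := merit_taylor n_gt0 Tsym Bsym Bpd.
have /andP[eta0 eta1] := h_eta.
(* The first bound gives a |p| <= 1. The second lets the fraction 1 - eta of the linear decrease
   absorb the quadratic term C (6 a |p|)^2. *)
exists (Num.min (M * Mg)^-1 ((1 - eta) * m / (36 * C * M ^+ 2))).
  by rewrite lt_min invr_gt0 mulr_gt0 // divr_gt0 ?mulr_gt0 ?subr_gt0
    ?exprn_gt0.
move=> x H a xS hH /andP[a0]; rewrite le_min => /andP[a1 a2].
have [h1 h2] := hH (g x); set p := - _.
have pE : enorm p = enorm (H *m g x) by rewrite enormN.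
have pg : dot p (g x) = - dot (g x) (H *m g x) by rewrite dotNl dotC.
have ap1 : a * enorm p <= 1.
  have h3 : enorm p <= M * Mg.
    by rewrite pE (le_trans h2) // ler_wpM2l ?(ltW M0) // hMg.
  rewrite -(@mulVf _ (M * Mg)) ?gt_eqF ?mulr_gt0 //.
  by rewrite ler_pM ?enorm_ge0 // ltW.
have gx := dot_merit_grad T k_gt0 (lt0r_neq0 (tform_gt0 Bpd xS)).
have pg0 : dot p (g x) <= 0.
  by rewrite pg oppr_le0 (le_trans _ h1) // mulr_ge0 ?sqr_ge0 // ltW.
rewrite /armijo.
have := hC x (curve x p a) xS (curve_unit_sphere p a xS).
have hd := dot_curve xS (ltW a0) ap1 gx pg0.
have he := curve_dist xS (ltW a0) ap1.
have he2 : enorm (curve x p a - x) ^+ 2 <= (6 * (a * enorm p)) ^+ 2.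
  by rewrite ler_sqr ?nnegrE ?enorm_ge0 // (le_trans _ he) ?enorm_ge0.
have := ler_wpM2l (ltW C0) he2 => he3 hf.
have hp : enorm p ^+ 2 <= M ^+ 2 * enorm (g x) ^+ 2.
  rewrite -exprMn ler_sqr ?nnegrE ?enorm_ge0 ?pE //.
  by rewrite (le_trans _ h2) ?enorm_ge0.
have key : C * (6 * (a * enorm p)) ^+ 2 <= a * (1 - eta) * - dot p (g x).
  have -> : C * (6 * (a * enorm p)) ^+ 2 = a * (36 * C * a * enorm p ^+ 2).
    by ring.
  rewrite -[leRHS]mulrA ler_wpM2l ?(ltW a0) // pg opprK.
  have h3 : a * (36 * C * M ^+ 2) <= (1 - eta) * m.
    by rewrite -ler_pdivlMr // ?mulr_gt0 ?exprn_gt0.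
  have h4 : 36 * C * a * enorm p ^+ 2 <=
      36 * C * a * (M ^+ 2 * enorm (g x) ^+ 2).
    by rewrite ler_wpM2l // !mulr_ge0 // ltW.
  apply: (le_trans h4).
  have h5 : (1 - eta) * (m * enorm (g x) ^+ 2) <=
      (1 - eta) * dot (g x) (H *m g x).
    by rewrite ler_wpM2l // subr_ge0 ltW.
  apply: le_trans h5.
  have := ler_wpM2r (sqr_ge0 (enorm (g x))) h3.
  rewrite -!mulrA; apply: le_trans.
  by rewrite le_eqVlt; apply/orP; left; apply/eqP; ring.
rewrite (_ : a * (1 - eta) * _ =
    - (a * dot p (g x)) + eta * a * dot p (g x)) in key;
  last by ring.
lra.
Qed.

Lemma cest_step_descent : exists2 c0, 0 < c0 & forall x c, (0 < c)%N ->
  sphere_until x c -> cest_step f g L eta beta kappa x c ->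
  unit_sphere (x c.+1) /\ f (x c.+1) <= f (x c) - c0 * enorm (g (x c)) ^+ 2.
Proof.
have [Mg Mg0 hMg] := merit_grad_bounded T n_gt0 Bpd.
have [m [M [m0 M0 hb]]] := lbfgs_bound kappa_gt0 Mg0 hMg L.
have [a0 a00 ha] := armijo_small_step m0 M0.
have /andP[eta0 eta1] := h_eta; have /andP[beta0 beta1] := h_beta.
pose a1 := Num.min 1 (beta * a0).
have a10 : 0 < a1 by rewrite lt_min ltr01 mulr_gt0.
exists (eta * a1 * m) => [|x c c0 xS]; first by rewrite !mulr_gt0.
move=> [gam [hg [l [hl lmin ->]]]].
have xcS : unit_sphere (x c) by apply: xS; rewrite c0 leqnn.
split; first exact: curve_unit_sphere.
have hH := hb x c gam c0 xS hg; set H := lbfgs _ _ _ _ _ _ _ in hH hl lmin *.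
have [h1 _] := hH (g (x c)).
(* If l = 0 the step is 1; otherwise the exponent l - 1 was rejected, so its step is at least [a0]
   and the accepted one at least beta * a0. *)
have al : a1 <= beta ^+ l.
  case: l lmin {hl} => [_|l lmin]; first by rewrite /a1 ge_min expr0 lexx.
  rewrite /a1 ge_min; apply/orP; right; rewrite exprS ler_wpM2l ?(ltW beta0) //.
  rewrite leNgt; apply/negP => bl; apply: (lmin l (ltnSn l)).
  by apply: ha => //; rewrite exprn_gt0 // ltW.
apply: (le_trans hl); rewrite lerD2l dotNl dotC mulrN lerN2.
have G0 := sqr_ge0 (enorm (g (x c))).
rewrite -[leLHS]mulrA; apply: ler_pM => //.
- by rewrite mulr_ge0 // ltW.
- by rewrite mulr_ge0 // ltW.
- by rewrite ler_wpM2l // ltW.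
Qed.

Lemma cest_run_limit x : cest_run f g L eta beta kappa x ->
  exists v, [/\ limiting_value f g x v, is_eigenvalue T B v & v <= f (x 1%N)].
Proof.
move=> [x1S step]; have [c0 c00 desc] := cest_step_descent.
(* A run is unconstrained after it stops, so the invariant reaches only as far as the first zero of
   the gradient. *)
have inv c : (0 < c)%N -> (forall i, (0 < i < c)%N -> g (x i) != 0) ->
    sphere_until x c /\ f (x c) <= f (x 1%N).
  elim: c => // -[_ _ _|c IH _ hg].
    split=> // j /andP[]; case: j => [|[|]] // _ _.
  have [|xS fle] := IH isT; first by move=> i ic; apply: hg; lia.
  have [|xS' fle'] := desc x c.+1 isT xS.
    by apply: step => // i ic; apply: hg; lia.
  split=> [j /andP[j0]|].
    by rewrite leq_eqVlt => /orP[/eqP -> //|jc]; apply: xS; rewrite j0.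
  apply: (le_trans fle'); rewrite lerBlDr (le_trans fle) // lerDl.
  by rewrite mulr_ge0 ?sqr_ge0 // ltW.
have eig y : unit_sphere y -> g y = 0 -> is_eigenvalue T B (f y).
  move=> yS gy; exists y; first exact: unit_sphere_neq0.
  by apply: merit_grad_eigenvalue => //; rewrite gt_eqF ?tform_gt0.
have [[c hc]|nstop] := pselect (exists c, (0 < c)%N && (g (x c) == 0)).
  have exc : exists c, (0 < c)%N && (g (x c) == 0) by exists c.
  case: (ex_minnP exc) => c' /andP[c'0 /eqP gc'] cmin.
  have hg i : (0 < i < c')%N -> g (x i) != 0.
    move=> /andP[i0 ic]; apply/negP => gi; move: ic; rewrite ltnNge => /negP.
    by apply; apply: cmin; rewrite i0.
  have [xS fle] := inv c' c'0 hg.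
  exists (f (x c')); split=> //; first by left; exists c'.
  by apply: eig => //; apply: xS; rewrite c'0 leqnn.
have gN0 c : (0 < c)%N -> g (x c) != 0.
  by move=> c_gt0; apply/negP => gc; apply: nstop; exists c; rewrite c_gt0.
have xS c : unit_sphere (x c.+1).
  have [xS _] := inv c.+1 isT (fun i hi => gN0 i (andP hi).1).
  by apply: xS; rewrite leqnn.
have fdec c : f (x c.+2) <= f (x c.+1) - c0 * enorm (g (x c.+1)) ^+ 2.
  have [xSc _] := inv c.+1 isT (fun i hi => gN0 i (andP hi).1).
  have stepc := step c.+1 isT (fun i hi => gN0 i (andP hi).1).
  by have [] := desc x c.+1 isT xSc stepc.
pose u c := f (x c.+1).
have [xm xmS fmin] := sphere_min n_gt0 (@continuous_merit R k n T B Bpd).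
have udec : nonincreasing_seq u.
  apply/nonincreasing_seqP => c; apply: (le_trans (fdec c)).
  by rewrite gerBl mulr_ge0 ?sqr_ge0 // ltW.
have ucvg : cvgn u.
  apply: nonincreasing_is_cvgn => //; exists (f xm) => _ [c _ <-].
  exact: fmin.
set v := limn u in ucvg.
have uv : u @ \oo --> v by exact: ucvg.
exists v.
have v1 : v <= f (x 1%N) by exact: (nonincreasing_cvgn_ge udec ucvg 0%N).
suff [y yS [fy gy]] : exists2 y, unit_sphere y & f y = v /\ g y = 0.
  split=> //; last by rewrite -fy; exact: eig.
  by right; split=> //; rewrite -cvg_shiftS.
have phic y : unit_sphere y ->
    {for y, continuous (fun z => `|f z - v| + enorm (g z))}.
  move=> yS; apply: continuousD.
    apply: (continuous_comp (f := fun z => f z - v)); last first.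
      exact: norm_continuous.
    by apply: continuousB; [exact: continuous_merit|exact: cst_continuous].
  apply: continuous_comp; first exact: continuous_merit_grad.
  exact: continuous_enorm.
(* Minimum 0 of |f - v| + |g| means a critical point of value v. A positive minimum e would force
   |g| > e/2 as soon as f(x_c) is within e/2 of v. *)
have [y yS hy] := sphere_min n_gt0 phic.
exists y => //; set e := _ + _ in hy.
have [e0|e0] := lerP e 0.
  have := normr_ge0 (f y - v); have := enorm_ge0 (g y) => h1 h2.
  have /eqP : `|f y - v| = 0 by move: e0; rewrite /e; lra.
  have /eqP : enorm (g y) = 0 by move: e0; rewrite /e; lra.
  by rewrite enorm_eq0 normr_eq0 subr_eq0 => /eqP ? /eqP ?.
exfalso.
(* Then one step decreases f by more than c0 (e/2)^2, which is twice the second bound, although both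
   values lie within [eps] of v. *)
pose eps := Num.min (e / 2) (c0 * e ^+ 2 / 8).
have eps0 : 0 < eps by rewrite lt_min !divr_gt0 ?mulr_gt0 ?exprn_gt0.
have /cvgrPdist_lt/(_ _ eps0)[N _ hN] := uv.
have d1 := hN N (leqnn N); have d2 := hN N.+1 (leqnSn N).
rewrite /= /u in d1 d2; have d3 := fdec N; have d4 := hy _ (xS N).
have eps1 : eps <= e / 2 by rewrite ge_min lexx.
have eps2 : eps <= c0 * e ^+ 2 / 8 by rewrite ge_min lexx orbT.
rewrite distrC in d1.
have ge2 : e / 2 < enorm (g (x N.+1)) by lra.
have : (e / 2) ^+ 2 < enorm (g (x N.+1)) ^+ 2.
  by rewrite ltr_sqr ?nnegrE ?enorm_ge0 // ltW // divr_gt0.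
rewrite -(ltr_pM2l c00) => d5.
have d1' := ler_norm (f (x N.+1) - v); have d2' := ler_norm (v - f (x N.+2)).
have : c0 * (e / 2) ^+ 2 = 2 * (c0 * e ^+ 2 / 8) by field.
lra.
Qed.

End Descent.

(** * The smallest eigenvalue *)

Lemma adjacency_tensor_symmetric (R : realType) k n (E : {set {set 'I_n}}) :
  symmetric_tensor (adjacency_tensor R k E).
Proof.
move=> s t st; rewrite !ffunE.
suff -> : [set i in s] = [set i in t] by [].
by apply/setP => i; rewrite !inE (perm_mem st).
Qed.

Lemma degree_tensor_symmetric (R : realType) k n (E : {set {set 'I_n}}) :
  symmetric_tensor (degree_tensor R k E).
Proof.
by move=> s t st; rewrite !ffunE; apply: eq_bigl => i; exact: perm_all.
Qed.

Lemma finite_set_right_gap (R : realType) (A : set R) (a : R) : finite_set A ->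
  exists2 b, a < b & forall c, A c -> c < b -> c <= a.
Proof.
move=> /finite_seqP[s ->] {A}; elim: s => [|c s [b ab hb]].
  by exists (a + 1) => //; rewrite ltrDl.
have [ca|ac] := lerP c a.
  by exists b => // e /=; rewrite inE => /orP[/eqP -> //|]; exact: hb.
exists (Num.min b c) => [|e /=]; first by rewrite lt_min ab.
rewrite inE lt_min => /orP[/eqP ->|es] /andP[eb ec].
  by rewrite ltxx in ec.
exact: hb.
Qed.

Section SmallestEigenvalue.
Variables (R : realType) (k n : nat) (T B : tensor R k n).
Hypotheses (k_gt0 : (0 < k)%N).
Hypotheses (Tsym : symmetric_tensor T) (Bsym : symmetric_tensor B).
Hypothesis Bpd : positive_definite B.
Local Notation f := (merit T B).

Variable x0 : 'cV[R]_n.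
Hypotheses (x0S : unit_sphere x0)
  (x0min : forall y, unit_sphere y -> f x0 <= f y).

Lemma merit_ge_min y : y != 0 -> f x0 <= f y.
Proof.
move=> yN0; have := x0min (normalize_unit_sphere yN0).
by rewrite meritZ // invr_eq0 enorm_eq0.
Qed.

(** With l = f(x0), the form of G = T - l B is nonnegative on the whole space by homogeneity and
    vanishes at [x0]. This unconstrained minimum forces the gradient of the form to vanish there. *)
Lemma min_merit_critical : tvec T x0 = f x0 *: tvec B x0.
Proof.
set l := f x0; pose G : tensor R k n := T - l *: B.
have Gsym : symmetric_tensor G by exact: symmetric_tensorB.
have [C C0 hC] := tform_taylor Gsym.
have Gge0 y : 0 <= tform G y.
  have [->|yN0] := eqVneq y 0.
    by rewrite -(scale0r (0 : 'cV[R]_n)) tformZ expr0n gtn_eqF // mul0r.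
  rewrite tformB subr_ge0 -ler_pdivlMr ?Bpd //.
  exact: merit_ge_min.
have Gx0 : tform G x0 = 0.
  rewrite tformB /l /merit divfK ?subrr // gt_eqF // Bpd //.
  exact: unit_sphere_neq0.
apply/eqP; rewrite -subr_eq0 -tvecB -/G -enorm_eq0; set w := tvec G x0.
apply: contraT => wN0.
have w0 : 0 < enorm w by rewrite lt_def wN0 enorm_ge0.
(* The step -t w stays in the range of the Taylor bound, and C t < 1 <= k makes the linear term win,
   so G would become negative. *)
pose t := Num.min (2 / enorm w) (1 / (2 * (C + 1))).
have C1 : 0 < 2 * (C + 1) by rewrite mulr_gt0 // ltr_wpDl.
have t0 : 0 < t by rewrite lt_min !divr_gt0.
have td : enorm (- t *: w) = t * enorm w by rewrite enormZ normrN gtr0_norm.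
have [||_ ] := hC x0 (- t *: w); first by rewrite x0S.
  by rewrite td -ler_pdivlMr // ge_min lexx.
rewrite Gx0 subr0 dotZr -enorm_sqr td => /(le_trans (ler_norm _)).
have := Gge0 (x0 + - t *: w) => h1 h2.
have h3 : C * t < 1.
  rewrite (@le_lt_trans _ _ (C * (1 / (2 * (C + 1))))) //.
    by rewrite ler_wpM2l // ge_min lexx orbT.
  by rewrite mulrA mulr1 ltr_pdivrMr //; lra.
have k1 : 1 <= k%:R :> R by rewrite ler1n.
have tw : 0 < t * enorm w ^+ 2 by rewrite mulr_gt0 // exprn_gt0.
have h4 := ler_wpM2r (ltW tw) k1.
have h5 : C * (t * enorm w) ^+ 2 = C * t * (t * enorm w ^+ 2) by ring.
have h6 : C * t * (t * enorm w ^+ 2) < 1 * (t * enorm w ^+ 2).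
  by rewrite ltr_pM2r.
have h7 : k%:R * (- t * enorm w ^+ 2) = - (k%:R * (t * enorm w ^+ 2)) by ring.
rewrite h5 h7 in h2; lra.
Qed.

Lemma smallest_eigenvalue : is_smallest_eigenvalue T B (f x0).
Proof.
split; first by exists x0; [exact: unit_sphere_neq0|exact: min_merit_critical].
move=> mu [x xN0 hx].
have [<- _] := eigenvalue_merit k_gt0 (lt0r_neq0 (Bpd xN0)) hx.
exact: merit_ge_min.
Qed.

End SmallestEigenvalue.

(** * Random initial points *)

Section SphereCover.
Variables (R : realType) (n : nat).
Implicit Types (x y : 'cV[R]_n) (U : set 'cV[R]_n).

(* A Householder reflection. *)
Lemma sphere_transitive x y : unit_sphere x -> unit_sphere y ->
  exists2 Q : 'M[R]_n, Q^T *m Q = 1%:M & Q *m x = y.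
Proof.
move=> /unit_sphere_dot xS /unit_sphere_dot yS.
pose v := x - y; have [v0|vN0] := eqVneq (dot v v) 0.
  exists 1%:M; first by rewrite trmx1 mulmx1.
  by rewrite mul1mx; apply/eqP; rewrite -subr_eq0 -dot_eq0 v0.
pose c := 2 / dot v v; pose Q : 'M[R]_n := 1%:M - c *: (v *m v^T).
have QT : Q^T = Q by rewrite /Q linearB linearZ /= trmx1 trmx_mul trmxK.
have vv : (v *m v^T) *m (v *m v^T) = dot v v *: (v *m v^T).
  by rewrite mulmxA outer_mul scalemxAl.
exists Q.
  have cc : c * c * dot v v = c + c by rewrite /c; field.
  rewrite QT /Q mulmxBl mul1mx mulmxBr mulmx1 -scalemxAl -scalemxAr vv !scalerA.
  by rewrite cc scalerDl opprB addrK subrK.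
rewrite /Q mulmxBl mul1mx -scalemxAl outer_mul scalerA.
have -> : c * dot v x = 1.
  have vv2 : dot v v = 2 * dot v x.
    by rewrite /v !(dotDl, dotDr, dotNl, dotNr) xS yS (dotC y x); ring.
  have vxN0 : dot v x != 0.
    by apply: contraNneq vN0 => e; rewrite vv2 e mulr0.
  by rewrite /c vv2; field.
by rewrite scale1r /v opprB addrCA subrr addr0.
Qed.

Lemma continuous_mulmx (Q : 'M[R]_n) : continuous (fun x : 'cV[R]_n => Q *m x).
Proof.
move=> x; apply: (@continuous_mx _ _ _ _ _
  (fun i j (y : 'cV[R]_n) => \sum_l Q i l * y l j)) => [i j y|i j].
  by rewrite mxE.
move: x; apply: continuous_big => [|l _ x]; first exact: add_continuous.
by apply: continuousM; [exact: cst_continuous|exact: coord_continuous].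
Qed.

Lemma sphere_cover U x0 : open U -> unit_sphere x0 -> U x0 ->
  exists s : seq 'M[R]_n, (forall Q, Q \in s -> Q^T *m Q = 1%:M) /\
    (forall y, unit_sphere y -> exists2 Q, Q \in s & U (Q *m y)).
Proof.
move=> oU x0S Ux0; have := @compact_unit_sphere R n; rewrite compact_cover.
move=> /(_ 'M[R]_n [set Q | Q^T *m Q = 1%:M] (fun Q => [set y | U (Q *m y)])).
case.
- by move=> Q _; have /continuousP cQ := @continuous_mulmx Q; exact: cQ.
- move=> y yS; have [Q Q1 Qy] := sphere_transitive yS x0S.
  by exists Q => //=; rewrite Qy.
move=> D hD cov; exists (finmap.enum_fset D); split.
  by move=> Q QD; exact: (set_mem (hD Q QD)).
by move=> y /cov[Q /= QD Uy]; exists Q.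
Qed.

End SphereCover.

Section Sampling.
Variables (R : realType) (n : nat).
Local Open Scope ereal_scope.

Lemma open_borel (U : set 'cV[R]_n) : open U -> borel_set U.
Proof. by move=> oU; exact: sub_gen_smallest. Qed.

(** The finite cover, and hence the bound, is fixed before the probability space and the random
    vector; this makes the final constant independent of N. *)
Lemma uniform_hit_probability (U : set 'cV[R]_n) (x0 : 'cV[R]_n) :
  open U -> unit_sphere x0 -> U x0 ->
  exists2 s : R, (0 < s <= 1)%R &
    forall d (Om : measurableType d) (P : probability Om R)
      (X : Om -> 'cV[R]_n),
      uniform_on_sphere P X -> s%:E <= P (X @^-1` U).
Proof.
move=> oU x0S Ux0; have [s [sorth scov]] := sphere_cover oU x0S Ux0.
have s0 : (0 < size s)%N.
  by have [Q Qs _] := scov x0 x0S; case: s Qs {sorth scov}.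
exists (size s)%:R^-1%R.
  by rewrite invr_gt0 ltr0n s0 invf_le1 ?ltr0n // ler1n.
move=> d Om P X [mX XS Xrot].
have bU := open_borel oU.
pose A i := (fun om => nth 0%R s i *m X om) @^-1` U.
have PA i : (i < size s)%N -> P (A i) = P (X @^-1` U).
  by move=> si; apply: Xrot => //; apply: sorth; exact: mem_nth.
have mA i : measurable (A i).
  apply: (mX [set y | U (nth 0%R s i *m y)]); apply: open_borel.
  have /continuousP cQ := @continuous_mulmx R n (nth 0%R s i).
  exact: cQ.
have : P (\big[setU/set0]_(i < size s) A i) <= \sum_(i < size s) P (A i).
  exact: (Boole_inequality _ (fun i _ => mA i)).
have -> : \big[setU/set0]_(i < size s) A i = setT.
  apply/seteqP; split=> // om _; rewrite -bigcup_mkord.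
  have [Q Qs UQ] := scov _ (XS om).
  exists (index Q s); first by rewrite /= index_mem.
  by rewrite /A /= nth_index.
rewrite probability_setT (eq_bigr (fun _ => P (X @^-1` U))) => [|i _]; last first.
  exact: PA.
have mU : measurable (X @^-1` U) by exact: mX.
rewrite -(fineK (fin_num_measure P _ mU)) sumEFin !lee_fin.
rewrite sumr_const card_ord -[X in (_ <= X)%R]mulr_natl.
by rewrite -ler_pdivrMl ?ltr0n // mulr1.
Qed.

(** F is the complement of the event that all N points miss U. It depends on the initial points
    only, hence is measurable whatever choices of gamma the runs make. *)
Lemma independent_hit_probability (U : set 'cV[R]_n) (s : R) d
    (Om : measurableType d) (P : probability Om R) N
    (X : 'I_N -> Om -> 'cV[R]_n) :
  borel_set U -> (s <= 1)%R -> (forall j, random_vector (X j)) ->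
  mutually_independent P X -> (forall j, s%:E <= P (X j @^-1` U)) ->
  exists2 F : set Om,
    measurable F /\ (forall om, F om -> exists j, U (X j om)) &
    (1 - (1 - s) ^+ N)%:E <= P F.
Proof.
move=> bU s1 mX ind hs.
pose G := [set om | forall j : 'I_N, j \in [set: 'I_N]%SET -> (~` U) (X j om)].
have bC := sigma_algebraC bU.
have mXU j : measurable (X j @^-1` U) by exact: mX.
have mG : measurable G.
  rewrite (_ : G = \big[setI/setT]_(j < N) (X j @^-1` (~` U))).
    by apply: bigsetI_measurable => j _; exact: mX.
  apply/seteqP; split=> om.
    by move=> h; rewrite -bigcap_seq => j _; apply: h; rewrite inE.
  by rewrite -bigcap_seq => h j _; apply: h; exact: mem_index_enum.
exists (~` G).
  split=> [|om /existsNP[j /not_implyP[_ /contrapT ?]]]; last by exists j.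
  exact: measurableC.
have PG : P G = \prod_(j in [set: 'I_N]%SET) P (X j @^-1` (~` U)).
  exact: ind _ (fun=> ~` U) (fun=> bC).
rewrite probability_setC // PG.
have PC j : P (X j @^-1` (~` U)) = (1 - fine (P (X j @^-1` U)))%:E.
  rewrite preimage_setC (probability_setC _ (mXU j)).
  by rewrite -(fineK (fin_num_measure P _ (mXU j))).
under eq_bigr do rewrite PC.
rewrite prodEFin -EFinB lee_fin lerD2l lerN2.
rewrite (eq_bigl predT) => [|j]; last by rewrite inE.
rewrite -[X in (_ <= _ ^+ X)%R](card_ord N) -prodr_const.
apply: ler_prod => j _; rewrite subr_ge0 lerD2l lerN2; apply/andP; split.
  by rewrite -lee_fin fineK ?fin_num_measure // probability_le1.
by rewrite -lee_fin fineK ?fin_num_measure.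
Qed.

End Sampling.

Lemma inner_prob_le1 (R : realType) d (Om : measurableType d)
    (P : probability Om R) (A : set Om) : (inner_prob P A <= 1)%E.
Proof. by apply: ge_ereal_sup => _ [F [mF _] <-]; exact: probability_le1. Qed.

Lemma cvg_success_bound (R : realType) (s : R) : 0 < s <= 1 ->
  ((1 - (1 - s) ^+ N)%:E @[N --> \oo] --> 1%E).
Proof.
move=> /andP[s0 s1]; apply: cvg_EFin; first exact: nearW.
rewrite -[X in _ --> X]subr0 /=; apply: cvgB; first exact: cvg_cst.
by apply: cvg_expr; rewrite ger0_norm ?subr_ge0 // gtrBl.
Qed.

Unset Implicit Arguments.

Theorem theorem5p11 (R : realType) (k n : nat) (E : {set {set 'I_n}})
    (T B : tensor R k n) (L : nat) (eta beta kappa : R)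
    (k_gt0 : (0 < k)%N) (k_even : ~~ odd k) (n_gt0 : (0 < n)%N)
    (hE : uniform_hypergraph k E)
    (hT : [\/ T = adjacency_tensor R k E,
              T = laplacian_tensor R k E
            | T = signless_laplacian_tensor R k E])
    (B_sym : symmetric_tensor B) (B_pd : positive_definite B)
    (L_gt0 : (0 < L)%N) (h_eta : 0 < eta < 1) (h_beta : 0 < beta < 1)
    (h_kappa : 0 < kappa < 1) :
  exists varsigma : R,
    [/\ 0 < varsigma <= 1,
        (forall (N : nat) (d : measure_display) (Om : measurableType d)
           (P : probability Om R) (X : 'I_N -> Om -> 'cV[R]_n)
           (x : 'I_N -> Om -> nat -> 'cV[R]_n),
           cest_experiment (merit T B) (merit_grad T B) L eta beta kappa
             P X x ->
           ((1 - (1 - varsigma) ^+ N)%:E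
              <= inner_prob P (obtains_smallest_eigenvalue T B x))%E)
      & forall (d : nat -> measure_display)
           (Om : forall N : nat, measurableType (d N))
           (P : forall N : nat, probability (Om N) R)
           (X : forall N : nat, 'I_N -> Om N -> 'cV[R]_n)
           (x : forall N : nat, 'I_N -> Om N -> nat -> 'cV[R]_n),
           (forall N : nat,
              cest_experiment (merit T B) (merit_grad T B) L eta beta kappa
                (P N) (X N) (x N)) ->
           inner_prob (P N) (obtains_smallest_eigenvalue T B (x N))
             @[N --> \oo] --> 1%E].
Proof.
have Tsym : symmetric_tensor T.
  have Dsym := @degree_tensor_symmetric R k n E.
  have Asym := @adjacency_tensor_symmetric R k n E.
  case: hT => -> //.
    rewrite /laplacian_tensor -[X in _ - X]scale1r.
    exact: symmetric_tensorB.
  rewrite /signless_laplacian_tensor -[X in _ + X]opprK -[X in _ - X]scaleN1r.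
  exact: symmetric_tensorB.
have kappa_gt0 : 0 < kappa by case/andP: h_kappa.
have [x0 x0S x0min] := sphere_min n_gt0 (@continuous_merit R k n T B B_pd).
have [lamE lammin] := smallest_eigenvalue k_gt0 Tsym B_sym B_pd x0S x0min.
set lam := merit T B x0 in lamE lammin.
have [lam2 lam12 gap] := finite_set_right_gap lam
  (finite_eigenvalues k_gt0 Tsym B_sym B_pd).
(* Stated without the quotient, which may be discontinuous at 0, so that U is open in the whole
   space; on the sphere it is {f < lam2}. *)
pose U := [set x : 'cV[R]_n | tform T x - lam2 * tform B x < 0].
have oU : open U.
  have cG : continuous (fun x : 'cV[R]_n => tform T x - lam2 * tform B x).
    move=> x; apply: continuousB; first exact: continuous_tform.
    by apply: continuousM; [exact: cst_continuous|exact: continuous_tform].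
  have /continuousP cG' := cG; exact: (cG' _ (@open_lt R 0)).
have UE x : unit_sphere x -> U x <-> merit T B x < lam2.
  by move=> xS; rewrite /U /merit /= subr_lt0 ltr_pdivrMr ?tform_gt0.
have Ux0 : U x0 by apply/UE.
have [s s01 hs] := uniform_hit_probability oU x0S Ux0.
have main N d (Om : measurableType d) (P : probability Om R)
    (X : 'I_N -> Om -> 'cV[R]_n) (x : 'I_N -> Om -> nat -> 'cV[R]_n) :
    cest_experiment (merit T B) (merit_grad T B) L eta beta kappa P X x ->
    ((1 - (1 - s) ^+ N)%:E
       <= inner_prob P (obtains_smallest_eigenvalue T B x))%E.
  move=> [unif ind run].
  have [||F [mF FU] hF] := independent_hit_probability (open_borel oU) _ _ ind
      (fun j => hs _ _ _ _ (unif j)).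
  - by case/andP: s01.
  - by move=> j; have [] := unif j.
  apply: (le_trans hF); apply: ereal_sup_ubound; exists F => //.
  split=> // om Fom.
  have /choice[v hv] j : exists v, [/\ limiting_value (merit T B)
      (merit_grad T B) (x j om) v, is_eigenvalue T B v
    & v <= merit T B (X j om)].
    have [<- runj] := run j om.
    exact: cest_run_limit k_gt0 n_gt0 Tsym B_sym B_pd h_eta h_beta kappa_gt0
      _ runj.
  exists v; split=> [j|]; first by have [] := hv j.
  exists lam; split; [|by move=> j; have [_ /lammin] := hv j|by []].
  have [j Uj] := FU om Fom; exists j; have [_ vE vle] := hv j.
  (* The limit of the run that starts in U is an eigenvalue below [lam2], so by the gap it is at
     most [lam]. *)
  apply/eqP; rewrite eq_le lammin // andbT; apply: gap => //.
  apply: (le_lt_trans vle); apply/UE => //.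
  by have [_ XS _] := unif j.
exists s; split=> // d Om P X x exps.
apply: (@squeeze_cvge _ _ _ _ (fun N => (1 - (1 - s) ^+ N)%:E) _ (fun=> 1%E)).
- apply: nearW => N; apply/andP; split; first exact: (main _ _ _ _ (X N)).
  exact: inner_prob_le1.
- exact: cvg_success_bound.
- exact: cvg_cst.
Qed.
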